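(* There are precisely thirty LDP-polygons of index two, up to unimodular equivalence.
   Context: Fix a lattice $N\cong\mathbb{Z}^2$ with dual lattice $M=\mathrm{Hom}(N,\mathbb{Z})$. A lattice polygon $Q\subset N\otimes_{\mathbb{Z}}\mathbb{Q}$ is the convex hull of finitely many points of $N$, with non-empty interior. $Q$ is an LDP-polygon if the origin lies in its (strict) interior and every vertex of $Q$ is a primitive lattice point (no lattice point lies strictly between the origin and the vertex). The facets of $Q$ are its edges. For a facet $F$, $\eta_F\in M$ is the unique primitive lattice point defining an outer normal of $F$, and the local index $l_F$ is the constant value of $\eta_F$ on $F$ (a positive integer). The index of $Q$ is $\ell_Q:=\mathrm{lcm}\{l_F : F\text{ a facet of }Q\}$. Two polygons are unimodularly equivalent if one is mapped to the other by an automorphism of the lattice $N$ (an element of $GL(2,\mathbb{Z})$). *)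

(* Defs.v *)
From mathcomp Require Import all_boot all_order all_algebra.
From mathcomp Require Import all_classical topology.

Set Implicit Arguments.
Unset Strict Implicit.
Unset Printing Implicit Defensive.

Import Order.TTheory GRing.Theory Num.Theory.
Local Open Scope classical_set_scope.
Local Open Scope ring_scope.

(* N = Z^2 is 'rV[int]_2 and M = Hom(N, Z) is 'cV[int]_2; they are embedded
   in N_Q = 'rV[rat]_2 and M_Q = 'cV[rat]_2 by toQ. *)
Definition toQ (m n : nat) (v : 'M[int]_(m, n)) : 'M[rat]_(m, n) :=
  map_mx intr v.

Definition pairing (u : 'cV[rat]_2) (x : 'rV[rat]_2) : rat := (x *m u) 0 0.

Definition primitive (m n : nat) (v : 'M[int]_(m, n)) : Prop :=
  v <> 0 /\
  forall (t : rat) (w : 'M[int]_(m, n)), 0 < t -> t < 1 -> toQ w <> t *: toQ v.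

Definition convex_hull (s : seq 'rV[rat]_2) : set 'rV[rat]_2 :=
  [set x | exists w : 'I_(size s) -> rat,
    [/\ forall i, 0 <= w i,
        \sum_(i < size s) w i = 1
      & x = \sum_(i < size s) w i *: s`_i]].

(* The type rat has no topology of its own: rat^o carries the order topology,
   and 'rV[rat^o]_2, convertible to 'rV[rat]_2, the product topology. *)
Definition polygon_interior (Q : set 'rV[rat]_2) : set 'rV[rat]_2 :=
  interior (Q : set 'rV[rat^o]_2).

Definition lattice_polygon (Q : set 'rV[rat]_2) : Prop :=
  (exists s : seq 'rV[int]_2, Q = convex_hull [seq toQ v | v <- s]) /\
  polygon_interior Q !=set0.

(* The face of Q on which the functional u attains its maximum over Q. *)
Definition face (Q : set 'rV[rat]_2) (u : 'cV[rat]_2) : set 'rV[rat]_2 :=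
  [set x | Q x /\ forall y, Q y -> pairing u y <= pairing u x].

Definition vertices (Q : set 'rV[rat]_2) : set 'rV[rat]_2 :=
  [set x | exists u : 'cV[rat]_2, face Q u = [set x]].

(* The edges: a face of a polygon given by u != 0 is at most one-dimensional,
   and is an edge iff it has at least two points. *)
Definition facets (Q : set 'rV[rat]_2) : set (set 'rV[rat]_2) :=
  [set F | (exists2 u : 'cV[rat]_2, u <> 0 & F = face Q u) /\
           (exists x y : 'rV[rat]_2, [/\ F x, F y & x <> y])].

Definition LDP_polygon (Q : set 'rV[rat]_2) : Prop :=
  [/\ lattice_polygon Q,
      polygon_interior Q 0
    & forall x, vertices Q x -> exists2 v : 'rV[int]_2, primitive v & x = toQ v].

(* eta_F; a lattice polygon has exactly one candidate for each facet, so the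
   default value 0 is not used. *)
Definition facet_normal (Q F : set 'rV[rat]_2) : 'cV[int]_2 :=
  xget 0 [set eta : 'cV[int]_2 | primitive eta /\ F = face Q (toQ eta)].

(* l_F; the default value 0 is not used when 0 lies in the interior of Q, the
   constant value being then a positive integer. *)
Definition local_index (Q F : set 'rV[rat]_2) : nat :=
  xget 0%N [set l : nat |
    forall x, F x -> pairing (toQ (facet_normal Q F)) x = l%:R].

Definition polygon_index (Q : set 'rV[rat]_2) : nat :=
  \big[lcmn/1%N]_(F \in facets Q) local_index Q F.

Definition unimodular_equiv (Q Q' : set 'rV[rat]_2) : Prop :=
  exists2 A : 'M[int]_2, A \in unitmx & Q' = [set x *m toQ A | x in Q].

(* Main.v *)
(* If the index is two, every facet F satisfies l_F <= 2, so a facet normal that is positive on a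
   lattice point x <> 0 bounds Q in direction x: no point beyond 2x lies in Q.  List the vertices
   counterclockwise, v_0, ..., v_(n-1).  The edge vectors sum to zero, hence some facet F satisfies
   eta_F(v_0 + ... + v_(n-1)) >= 0 (a "special facet").  By convexity each height eta_F is attained
   by at most two vertices, so the nonnegativity of the sum of the heights, all at most l_F <= 2,
   bounds them below by -6.  Normalise F by SL(2, Z) to lie on x = 1 or x = 2; the axis x = 0 meets
   Q in a segment contained in [-2, 2], which bounds the other coordinate of all vertices.  A
   depth-first search over the closed convex lattice paths in the resulting box finds finitely many
   polygons, and each one of index two is equivalent to exactly one of thirty representatives. *)

Require Import Defs.
From mathcomp Require Import all_boot all_order all_algebra.
From mathcomp Require Import all_classical topology.
From mathcomp Require Import zify ring lra.

Set Implicit Arguments.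
Unset Strict Implicit.
Unset Printing Implicit Defensive.

Import Order.TTheory GRing.Theory Num.Theory.
Local Open Scope classical_set_scope.
Local Open Scope ring_scope.

(** * Supporting edges of a finite set of lattice points *)

(** The sets of rational points in the statement cannot be searched by computation, so a polygon is
    traded for the counterclockwise cycle of its vertices, a list of integer pairs. Convexity, the
    position of the origin, edges, local indices and equivalence then become signs and
    divisibilities of 2 x 2 determinants, which serve both as hypotheses for the bounds and as
    pruning tests for the search. The bounds use only that every local index divides 2; index-one
    polygons may therefore turn up in the search as well and are discarded by their index.
    Inequivalence of the representatives is also a finite check: an equivalence carries vertices to
    vertices and is determined by the images of two consecutive ones, which form a basis of the
    rational plane. *)

Definition det (u v : int * int) : int := u.1 * v.2 - u.2 * v.1.

Definition dot (u v : int * int) : int := u.1 * v.1 + u.2 * v.2.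

Definition turn (u v x : int * int) : int := det (v - u) (x - u).

(* [u] -> [v] is a full edge of the convex hull of [S], traversed with [S] on its left. *)
Definition supp (S : seq (int * int)) (u v : int * int) : bool :=
  [&& u \in S, v \in S, u != v & all (fun x => (0 < turn u v x) ||
    [&& turn u v x == 0, 0 <= dot (v - u) (x - u) & dot (v - u) (x - v) <= 0]) S].

Definition surrounds (S : seq (int * int)) : Prop :=
  forall e : int * int, e != 0 -> exists2 x, x \in S & 0 < det e x.

Lemma dot_gt0 (e : int * int) : e != 0 -> 0 < dot e e.
Proof.
case: e => a b; rewrite /dot /= => e0.
have : (a != 0) || (b != 0) by rewrite -negb_and.
nia.
Qed.

(** Totality and transitivity are asked on [s] only, since the angular order used for gift wrapping
    is transitive only inside a half-plane. *)
Lemma seq_best (T : eqType) (r : rel T) (s : seq T) :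
  {in s &, total r} -> {in s & &, transitive r} -> s != [::] ->
  exists2 x, x \in s & {in s, forall y, r x y}.
Proof.
elim: s => // x s IH tot tr _.
have sub y : y \in s -> y \in x :: s by rewrite inE orbC => ->.
have rr y : y \in x :: s -> r y y by move=> ys; have := tot y y ys ys; case: (r y y).
case: (eqVneq s [::]) => [->|s0].
  by exists x; rewrite ?mem_head // => y; rewrite inE => /eqP ->; apply: rr; apply: mem_head.
have [||w ws best] := IH _ _ s0.
- by move=> a b /sub ? /sub; apply: tot.
- by move=> a b c /sub ? /sub ? /sub; apply: tr.
have xs := mem_head x s.
case/orP: (tot x w xs (sub _ ws)) => [rxw|rwx].
  exists x => // y; rewrite inE => /orP[/eqP ->|ys]; first exact: rr.
  by apply: (tr w) => //; [apply: sub| apply: sub | apply: best].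
by exists w; [apply: sub | move=> y; rewrite inE => /orP[/eqP ->//|]; apply: best].
Qed.

(** The next edge is found by rotating the ray from [v] in direction [e] counterclockwise until it
    first meets points of [S]; among these the farthest is taken. *)
Lemma gift_wrap (S : seq (int * int)) (v e : int * int) :
  v \in S -> surrounds S -> e != 0 ->
  (forall x, x \in S -> x = v \/ 0 < det e (x - v) \/
     (det e (x - v) = 0 /\ dot e (x - v) < 0)) ->
  exists w, supp S v w.
Proof.
move=> vS sur e0 side.
pose f x := det e (x - v).
pose r x y := (0 < turn v x y) || (turn v x y == 0) && (f y <= f x).
pose s := [seq x <- S | 0 < f x].
(* A point with [det (- e)] positive forces [det e v < 0], so the point with [det e] positive is
   strictly left of the line through [v]. *)
have s0 : s != [::].
  have [x xS fx] := sur e e0.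
  have [y yS fy] : exists2 y, y \in S & 0 < det (- e) y by apply: sur; rewrite oppr_eq0.
  suff : x \in s by case: (s).
  rewrite mem_filter xS andbT.
  have : f y >= 0.
    by case: (side y yS) => [->|[|[]]]; rewrite /f /det /= ; lia.
  by move: fx fy; rewrite /f /det /=; lia.
have [||w] := @seq_best _ r s _ _ s0.
- move=> x y; rewrite !mem_filter => /andP[fx _] /andP[fy _].
  by rewrite /r; move: fx fy; rewrite /f /turn /det /=; lia.
- move=> y x z; rewrite !mem_filter => /andP[fy _] /andP[fx _] /andP[fz _].
  (* The three-term Plücker relation; as [f] is positive on [s], it yields transitivity. *)
  have id : turn v x y * f z + turn v y z * f x = turn v x z * f y.
    by rewrite /turn /f /det /=; ring.
  move: fx fy fz id; rewrite /r.
  move: (f x) (f y) (f z) (turn v x y) (turn v y z) (turn v x z) => a b c p q t.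
  by move=> a0 b0 c0 id /orP[p0|/andP[/eqP p0 h]] /orP[q0|/andP[/eqP q0 h']]; nia.
rewrite mem_filter => /andP[fw wS] best; exists w.
have nvw : v != w by apply: contraTneq fw => <-; rewrite /f /det /= !subrr; lia.
rewrite /supp vS wS nvw /=; apply/allP => x xS.
have ee : 0 < dot e e by apply: dot_gt0.
have id1 : turn v w x * dot e e = dot e (w - v) * f x - f w * dot e (x - v).
  by rewrite /turn /f /det /dot /=; ring.
case: (side x xS) => [->|[fx|[fx hx]]].
- have ww : 0 < dot (w - v) (w - v) by apply: dot_gt0; rewrite subr_eq0 eq_sym.
  by apply/orP; right; move: ww; rewrite /turn /det /dot /= !subrr; lia.
- have : r w x by apply: best; rewrite mem_filter fx xS.
  case/orP => [->//|/andP[/eqP t0 le]]; apply/orP; right; rewrite t0 eqxx /=.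
  move: t0 fw fx le; rewrite /f /turn /det /dot /=.
  move: (w) (v) (x) (e) => [w1 w2] [v1 v2] [x1 x2] [e1 e2] /=.
  have -> : x1 - w1 = (x1 - v1) - (w1 - v1) by ring.
  have -> : x2 - w2 = (x2 - v2) - (w2 - v2) by ring.
  move: (w1 - v1) (w2 - v2) (x1 - v1) (x2 - v2) => p q a b t0 fw fx le.
  have pq : 0 <= p * p + q * q by nia.
  have E1 : (p * a + q * b) * (e1 * q - e2 * p) = (p * p + q * q) * (e1 * b - e2 * a)
     - (p * e1 + q * e2) * (p * b - q * a) by ring.
  have -> : p * (a - p) + q * (b - q) = (p * a + q * b) - (p * p + q * q) by ring.
  move: E1; rewrite t0 mulr0 subr0.
  move: fw fx le pq; move: (p * a + q * b) (p * p + q * q).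
  move: (e1 * q - e2 * p) (e1 * b - e2 * a) => F G N D F0 G0 le D0 E1.
  by apply/andP; split; nia.
- apply/orP; left; move: id1; rewrite /f fx mulr0 sub0r => id1.
  move: fw ee hx id1; rewrite /f.
  move: (turn _ _ _) (dot e e) (det _ _) (dot e _) => a b c d; nia.
Qed.

Lemma pair_neq (x y : int * int) : x != y -> x.1 != y.1 \/ x.2 != y.2.
Proof. by move=> h; apply/orP; rewrite -negb_and; apply: h. Qed.

Lemma supp_next (S : seq (int * int)) (u v : int * int) :
  surrounds S -> supp S u v -> exists w, supp S v w.
Proof.
move=> sur /and4P[uS vS nuv /allP h].
apply: (@gift_wrap _ _ (v - u)) => //; first by rewrite subr_eq0 eq_sym.
have ee : 0 < dot (v - u) (v - u) by apply: dot_gt0; rewrite subr_eq0 eq_sym.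
move=> x /h; have -> : turn u v x = det (v - u) (x - v) by rewrite /turn /det /=; ring.
case/orP=> [|/and3P[/eqP t0 _ d0]]; first by right; left.
case: (eqVneq x v) => [|nxv]; [by left|right; right; split=> //].
rewrite lt_neqAle d0 andbT; apply: contra nxv => /eqP d1; rewrite -subr_eq0.
move: t0 d1 ee; rewrite /det /dot -pair_eqE /=.
move: (v.1 - u.1) (v.2 - u.2) (x.1 - v.1) (x.2 - v.2) => a b c d.
move=> t0 d1 n0.
have c0 : c * (a * a + b * b) = 0.
  have -> : c * (a * a + b * b) = a * (a * c + b * d) - b * (a * d - b * c) by ring.
  by rewrite t0 d1 !mulr0 subr0.
have d0' : d * (a * a + b * b) = 0.
  have -> : d * (a * a + b * b) = b * (a * c + b * d) + a * (a * d - b * c) by ring.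
  by rewrite t0 d1 !mulr0 addr0.
by move: c0 d0' n0; move: (a * a + b * b) => N; nia.
Qed.

(** The walk starts at the lexicographically largest point, facing up: all other points lie to its
    left or straight behind it. *)
Lemma supp_first (S : seq (int * int)) :
  surrounds S -> exists u v, supp S u v.
Proof.
move=> sur.
pose r (x y : int * int) := (y.1 < x.1) || (y.1 == x.1) && (y.2 <= x.2).
have [v vS best] : exists2 v : int * int, v \in S & forall x : int * int, x \in S -> r v x.
  apply: seq_best; rewrite /r.
  - by move=> x y _ _ /=; lia.
  - by move=> y x z _ _ _ /=; lia.
  - by case: (S) (sur (1, 0) isT) => // [[]].
have [|w vw] := @gift_wrap S v (0, 1) vS sur isT; last by exists v, w.
move=> x /best; rewrite /r /det /dot /= => h.
case: (eqVneq x v) => [|nxv]; [by left|right].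
by move: nxv h => /pair_neq; lia.
Qed.

(** Some point of [S] lies strictly right of the parallel to the edge through 0, yet not right of
    the edge itself, so 0 is strictly left of the edge. *)
Lemma supp_det_gt0 (S : seq (int * int)) (u v : int * int) :
  surrounds S -> supp S u v -> 0 < det u v.
Proof.
move=> sur /and4P[uS vS nuv /allP h].
have [x xS] : exists2 x, x \in S & 0 < det (u - v) x by apply: sur; rewrite subr_eq0.
by have := h x xS; rewrite /turn /det /=; lia.
Qed.

(** Iterating a chosen successor must repeat a value, and the stretch up to the first repetition
    contains a duplicate-free cycle. Thus gift wrapping need not be shown to return to its starting
    point. *)
Lemma serial_cycle (T : eqType) (S : seq T) (r : rel T) (x : T) :
  (forall x, x \in S -> has (r x) S) -> x \in S ->
  exists c : seq T, [/\ c != [::], uniq c & cycle r c].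
Proof.
move=> ser xS.
pose f a := nth a S (find (r a) S).
have fS a : a \in S -> f a \in S by move=> /ser; rewrite has_find; apply: mem_nth.
have rf a : a \in S -> r a (f a) by move=> /ser; apply: nth_find.
have itS n : iter n f x \in S by elim: n => //= n; apply: fS.
have ex : exists n, looping f x n.
  exists (size S); rewrite -[looping _ _ _]negbK -looping_uniq; apply/negP => U.
  have : (size (traject f x (size S).+1) <= size S)%N.
    by apply: uniq_leq_size => // y /trajectP[i _ ->].
  by rewrite size_traject ltnn.
case: (ex_minnP ex) => n /trajectP[k kn itk] min.
have [m en] : exists m, n = (k + m.+1)%N by exists (n - k).-1; lia.
exists (traject f (iter k f x) m.+1); split=> //.
  have : uniq (traject f x n).
    case: (n) min {kn itk en} => // p min; rewrite looping_uniq.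
    by apply/negP => /min; rewrite ltnn.
  by rewrite en trajectD cat_uniq => /and3P[].
have : fcycle f (traject f (iter k f x) m.+1).
  rewrite /= rcons_path fpath_traject last_traject /=.
  by rewrite -iterS -iterD addnC -en itk.
apply: (@sub_in_cycle _ (mem S)); last by apply/allP => y /trajectP[i _ ->]; rewrite -iterD;
  apply: itS.
by move=> y z yS _ /eqP <-; apply: rf.
Qed.

(** * Counterclockwise vertex cycles *)

(* [c] lists the vertices of a polygon containing 0 in its interior, counterclockwise and without
   intermediate points on the edges; [next] closes up the cycle. *)
Definition cvx (c : seq (int * int)) : bool :=
  [&& uniq c, c != [::] & all (fun u => (0 < det u (next c u)) &&
    all (fun x => [|| x == u, x == next c u | 0 < turn u (next c u) x]) c) c].

(** This is [q = (dot p q / dot p p) p] with denominators cleared, paired with a third vector. *)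
Lemma colinear_scale (p q : int * int) : det p q = 0 ->
  forall g, det g q * dot p p = dot p q * det g p /\
            dot g q * dot p p = dot p q * dot g p.
Proof.
move=> pq g.
have q1 : q.1 * dot p p = dot p q * p.1.
  have -> : q.1 * dot p p = dot p q * p.1 - p.2 * det p q by rewrite /dot /det; ring.
  by rewrite pq mulr0 subr0.
have q2 : q.2 * dot p p = dot p q * p.2.
  have -> : q.2 * dot p p = dot p q * p.2 + p.1 * det p q by rewrite /dot /det; ring.
  by rewrite pq mulr0 addr0.
split.
  have -> : det g q * dot p p = g.1 * (q.2 * dot p p) - g.2 * (q.1 * dot p p) by rewrite {1}/det;
    ring.
  by rewrite q1 q2 /det; ring.
have -> : dot g q * dot p p = g.1 * (q.1 * dot p p) + g.2 * (q.2 * dot p p) by rewrite {1}/dot;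
  ring.
by rewrite q1 q2 [dot g p]/dot; ring.
Qed.

(** If [x] lay inside the segment from [u] to [v], the opposite vectors [u - x] and [v - x] would
    both have to point to the left of [x -> y] or forward along it, which is impossible. *)
Lemma supp_strict (S : seq (int * int)) (u v x y : int * int) :
  supp S u v -> supp S x y -> x != u -> x != v -> 0 < turn u v x.
Proof.
move=> /and4P[uS vS nuv /allP suv] /and4P[xS yS nxy /allP sxy] nxu nxv.
case/orP: (suv x xS) => // /and3P[/eqP t0 d1 d2]; exfalso.
have P0 : 0 < dot (x - u) (x - u) by apply: dot_gt0; rewrite subr_eq0.
have Q0 : 0 < dot (v - x) (v - x) by apply: dot_gt0; rewrite subr_eq0 eq_sym.
have G0 : 0 < dot (y - x) (y - x) by apply: dot_gt0; rewrite subr_eq0 eq_sym.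
have E0 : 0 < dot (v - u) (v - u) by apply: dot_gt0; rewrite subr_eq0 eq_sym.
have pq : det (x - u) (v - x) = 0 by move: t0; rewrite /turn /det /=; lia.
have sc := colinear_scale pq.
have [_ sq] := sc (v - x).
have dpq : 0 < dot (x - u) (v - x).
  have e1 : dot (v - u) (x - u) = dot (x - u) (x - u) + dot (x - u) (v - x) by rewrite /dot /=;
    ring.
  have e2 : dot (v - u) (x - v) = - (dot (v - x) (v - x) + dot (x - u) (v - x))
    by rewrite /dot /=; ring.
  have e3 : dot (v - u) (v - u) = dot (x - u) (x - u) + dot (v - x) (v - x) + 2 * dot (x - u) (v
    - x) by rewrite /dot /=; ring.
  have e4 : dot (v - x) (x - u) = dot (x - u) (v - x) by rewrite /dot /=; ring.
  move: sq d1 d2 P0 Q0 E0; rewrite e1 e2 e3 e4.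
  by move: (dot _ _) (dot _ _) (dot _ _) => P Q k; nia.
have [s1 s2] := sc (y - x).
have tu : turn x y u = - det (y - x) (x - u) by rewrite /turn /det /=; ring.
have tv : turn x y v = det (y - x) (v - x) by rewrite /turn /det /=; ring.
have du : dot (y - x) (u - x) = - dot (y - x) (x - u) by rewrite /dot /=; ring.
have id : dot (y - x) (y - x) * dot (x - u) (x - u) = det (y - x) (x - u) ^+ 2 + dot (y - x) (x -
  u) ^+ 2.
  by rewrite /dot /det /=; ring.
have := sxy u uS; have := sxy v vS; rewrite tu tv du.
move: s1 s2 id P0 G0 dpq.
move: (det (y - x) (x - u)) (det (y - x) (v - x)) (dot (x - u) (v - x)) => a b k.
move: (dot (y - x) (x - u)) (dot (y - x) (v - x)) (dot (x - u) (x - u)) (dot (y - x) (y - x)) =>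
  f h P G.
move=> s1 s2 id P0 G0 k0 c1 c2.
have a0 : a = 0 by case/orP: c1 => [?|/and3P[/eqP ? _ _]]; case/orP: c2 => [?|/and3P[? _ _]]; nia.
have b0 : b = 0 by nia.
move: c1 c2; rewrite a0 b0 oppr0 ltxx eqxx /= => /andP[h0 _] /andP[f0 _].
have f00 : f = 0 by nia.
by move: id; rewrite a0 f00; nia.
Qed.

Lemma supp_cycle_cvx (S c : seq (int * int)) :
  surrounds S -> c != [::] -> uniq c -> cycle (supp S) c -> cvx c.
Proof.
move=> sur c0 uc cyc; rewrite /cvx uc c0 /=.
apply/allP => u uc'; have suv := next_cycle cyc uc'.
rewrite (supp_det_gt0 sur suv) /=; apply/allP => x xc.
case: eqVneq => //= nxu; case: eqVneq => //= nxv.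
exact: supp_strict suv (next_cycle cyc xc) nxu nxv.
Qed.

Lemma cvx_exists (S : seq (int * int)) : surrounds S ->
  exists c, [/\ cvx c, {subset c <= S} & cycle (supp S) c].
Proof.
move=> sur; have [u0 [v0 s0]] := supp_first sur.
(* [supp_next] needs an incoming edge, so the relation is serial on the end points of supporting
   edges. *)
pose E := [seq v <- S | has (fun u => supp S u v) S].
have v0E : v0 \in E.
  case/and4P: (s0) => uS vS _ _.
  by rewrite mem_filter vS andbT; apply/hasP; exists u0.
have [|c [c0 uc cyc]] := @serial_cycle _ E (supp S) v0 _ v0E.
  move=> v; rewrite mem_filter => /andP[/hasP[u uS suv] vS].
  have [w svw] := supp_next sur suv.
  apply/hasP; exists w => //; case/and4P: (svw) => _ wS _ _.
  by rewrite mem_filter wS andbT; apply/hasP; exists v.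
exists c; split=> //; first exact: supp_cycle_cvx cyc.
by move=> x /(next_cycle cyc) /and4P[].
Qed.

Lemma cvx_uniq c : cvx c -> uniq c.
Proof. by case/and3P. Qed.

Lemma cvx_det c (u : int * int) : cvx c -> u \in c -> 0 < det u (next c u).
Proof. by case/and3P=> _ _ /allP h /h /andP[]. Qed.

Lemma cvx_turn c (u x : int * int) : cvx c -> u \in c -> x \in c -> x != u -> x != next c u ->
  0 < turn u (next c u) x.
Proof.
case/and3P=> _ _ /allP h /h /andP[_ /allP k] /k.
by case: eqVneq => //= _; case: eqVneq.
Qed.

Lemma turn_id u v : (turn u v u = 0) * (turn u v v = 0).
Proof. by rewrite /turn /det /=; split; ring. Qed.

Lemma cvx_turn_ge0 c (u x : int * int) : cvx c -> u \in c -> x \in c -> 0 <= turn u (next c u) x.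
Proof.
move=> cc uc xc; have := cvx_turn cc uc xc.
case: (eqVneq x u) => [->|_]; first by rewrite turn_id.
case: (eqVneq x (next c u)) => [->|_]; first by rewrite turn_id.
by move=> /(_ isT isT) /ltW.
Qed.

(** Implication between values of [P] is transitive, and a transitive relation that holds along a
    cycle holds between any two of its members. *)
Lemma next_ind (T : eqType) (c : seq T) (P : pred T) (u : T) :
  uniq c -> {in c, forall x, P x -> P (next c x)} -> u \in c -> P u -> {in c, forall x, P x}.
Proof.
move=> uc h uc' Pu.
have : cycle (fun x y => P x ==> P y) c.
  by apply: cycle_from_next => // x xc; apply/implyP; apply: h.
rewrite cycle_all2rel; last by move=> x y z; case: (P y) (P x) => [] [].
by move=> /allrelP imp x xc; apply: (implyP (imp _ _ uc' xc)).
Qed.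

(** Generic in [R] because cones are used for lattice directions in the bounds and for rational
    points of the polygon. *)
Definition pdet (R : pzRingType) (u : int * int) (x : R * R) : R :=
  u.1%:~R * x.2 - u.2%:~R * x.1.

(* Each [x] lies in the cone over some edge: otherwise [det _ x] would have constant sign on [c];
   on an open half-plane the relation [0 < det u v] is transitive,
     so it cannot hold along a cycle. *)
Lemma cvx_cone (R : realDomainType) (c : seq (int * int)) (x : R * R) : cvx c ->
  exists2 u : int * int, u \in c & 0 <= pdet u x /\ pdet (next c u) x <= 0.
Proof.
move=> cc.
have no (s : R) : ~ {in c, forall u, 0 < s * pdet u x}.
  move=> pos; have : cycle (fun u v => 0 < det u v) c.
    by apply: cycle_from_next (cvx_uniq cc) _ => u; apply: cvx_det.
  rewrite (@cycle_all2rel_in _ (mem c)); last by apply/allP.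
    case/and3P: cc => _; case: c {pos} => // u c _ _ /allrelP h.
    by have := h u u (mem_head _ _) (mem_head _ _); rewrite /det; lia.
  move=> b a d /pos b0 /pos a0 /pos d0 ab bd.
  have id : (det a b)%:~R * (s * pdet d x) + (det b d)%:~R * (s * pdet a x) = (det a d)%:~R * (s
    * pdet b x).
    by rewrite /pdet /det !(rmorphB, rmorphM) /=; ring.
  rewrite -(ltr0z R) -(pmulr_lgt0 _ b0) -id.
  by rewrite addr_gt0 // mulr_gt0 // ltr0z.
case: (boolP (has (fun u => (0 <= pdet u x) && (pdet (next c u) x <= 0)) c)).
  by case/hasP=> u uc /andP[h k]; exists u.
move=> /hasPn h; exfalso.
case: (boolP (has (fun u => 0 <= pdet u x) c)) => [/hasP[u uc u0]|/hasPn neg].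
  have ge : {in c, forall u, 0 <= pdet u x}.
    apply: (next_ind (cvx_uniq cc) _ uc u0) => v vc v0.
    by have := h v vc; rewrite v0 /= -ltNge => /ltW.
  apply: (no 1) => v vc; rewrite mul1r.
  have pc : prev c v \in c by rewrite mem_prev.
  have := h _ pc; rewrite (ge _ pc) /= -ltNge.
  by rewrite next_prev ?cvx_uniq.
by apply: (no (-1)) => v /neg; rewrite -ltNge mulN1r oppr_gt0.
Qed.

(** * Boundedness of polygons of index at most two *)

(* The local index of the edge from [u] to [v] is [det u v] divided by the gcd of the coordinates of
   [v - u]; [low u v] says that it divides 2. *)
Definition low (u v : int * int) : bool :=
  (det u v %| 2 * (v.1 - u.1))%Z && (det u v %| 2 * (v.2 - u.2))%Z.

Definition lows (c : seq (int * int)) : bool := all (fun u => low u (next c u)) c.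

(* Let [eta] be the normal of the edge crossed by the ray through [x], [l] its local index.  Then
   [eta x >= 1], while [eta a] and [eta b] are at most [l <= 2]. *)
Lemma axis_bound c (a b x : int * int) (p q m : int) :
  cvx c -> lows c -> a \in c -> b \in c -> 0 <= p -> 0 <= q -> x != 0 ->
  p * a.1 + q * b.1 = m * x.1 -> p * a.2 + q * b.2 = m * x.2 ->
  m <= 2 * (p + q).
Proof.
move=> cc /allP lc ac bc p0 q0 x0 e1 e2.
have [u uc [s1 s2]] := cvx_cone x cc.
have d0 := cvx_det cc uc.
have := lc u uc; rewrite /low.
have := cvx_turn_ge0 cc uc ac; have := cvx_turn_ge0 cc uc bc.
move: (next c u) d0 s1 s2 => v.
rewrite /pdet !intz -/(det u x) -/(det v x) => d0 s1 s2.
pose D y := det y (v - u).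
have Dt y : turn u v y = det u v - D y by rewrite /turn /D /det /=; ring.
rewrite !Dt => tb ta /andP[/dvdzP[k1 h1] /dvdzP[k2 h2]].
have Dx : D x = det u x - det v x by rewrite /D /det /=; ring.
have Dx0 : D x != 0.
  apply: contra x0 => /eqP z; have [z1 z2] : det u x = 0 /\ det v x = 0 by lia.
  have i1 : det u v * x.1 = v.1 * det u x - u.1 * det v x by rewrite /det; ring.
  have i2 : det u v * x.2 = v.2 * det u x - u.2 * det v x by rewrite /det; ring.
  move: i1 i2; rewrite z1 z2 !mulr0 subr0 => /eqP i1 /eqP i2.
  move: i1 i2; rewrite !mulf_eq0 (gt_eqF d0) /= => h h'.
  by rewrite -pair_eqE /= /pair_eq h h'.
(* [D] is eta times the lattice length of the edge, so the factor of [det u v] is [2 * eta x / l],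
   an integer since l divides 2. *)
have i3 : 2 * D x = (x.1 * k2 - x.2 * k1) * det u v.
  have -> : 2 * D x = x.1 * (2 * (v.2 - u.2)) - x.2 * (2 * (v.1 - u.1)) by rewrite /D /det /=; ring.
  by rewrite h1 h2; ring.
have i4 : m * D x = p * D a + q * D b.
  have -> : m * D x = (m * x.1) * (v.2 - u.2) - (m * x.2) * (v.1 - u.1) by rewrite /D /det /=; ring.
  by rewrite -e1 -e2 /D /det /=; ring.
move: d0 ta tb Dx0 i3 i4 Dx s1 s2.
move: (D a) (D b) (D x) (x.1 * k2 - x.2 * k1) (det u v) (det u x) (det v x).
move=> A B X K d f g d0 ta tb X0 i3 i4 Xe f0 g0.
have Xp : 0 < X by lia.
have K1 : 1 <= K by nia.
have i5 : m * X <= (p + q) * d by rewrite i4; nia.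
have i6 : d <= 2 * X by nia.
have i7 : m * X <= (p + q) * (2 * X) by nia.
rewrite -(ler_pM2r Xp); lia.
Qed.

(** The segment from [a] to [z] crosses the axis at second coordinate
    [(a.1 * z.2 - z.1 * a.2) / (a.1 - z.1)], and [axis_bound] applies in both directions of the
    axis. *)
Lemma height_bound c (a z : int * int) : cvx c -> lows c -> a \in c -> z \in c -> 0 < a.1 -> z.1
  < 0 ->
  `|a.1 * z.2 - z.1 * a.2| <= 2 * (a.1 - z.1).
Proof.
move=> cc lc ac zc a0 z0.
have h1 := @axis_bound c a z (0, 1) (- z.1) a.1 (a.1 * z.2 - z.1 * a.2) cc lc ac zc _ _ isT.
have h2 := @axis_bound c a z (0, -1) (- z.1) a.1 (- (a.1 * z.2 - z.1 * a.2)) cc lc ac zc _ _ isT.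
have {}h1 : (a.1 * z.2 - z.1 * a.2) <= 2 * (- z.1 + a.1) by apply: h1 => /=;
  [lia | lia | ring | ring].
have {}h2 : - (a.1 * z.2 - z.1 * a.2) <= 2 * (- z.1 + a.1) by apply: h2 => /=;
  [lia | lia | ring | ring].
lia.
Qed.

Lemma cvx_neg c : cvx c -> exists2 z : int * int, z \in c & z.1 < 0.
Proof.
move=> cc; have [u uc [s1 s2]] := cvx_cone (-1 : int, 0 : int) cc.
have d0 := cvx_det cc uc.
have vc : next c u \in c by rewrite mem_next.
case: (ltP u.1 0) => [|u1]; first by exists u.
case: (ltP (next c u).1 0) => [|v1]; first by exists (next c u).
exfalso; move: s1 s2 d0 u1 v1; rewrite /pdet /det !intz /=; nia.
Qed.

(** [x] and [z] lie in opposite directions from [y], so the edge leaving [y] can neither have both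
    on its left nor end at one of them. *)
Lemma cvx_noncollinear c (x y z : int * int) : cvx c -> x \in c -> y \in c -> z \in c ->
  x.1 = y.1 -> y.1 = z.1 -> x.2 < y.2 -> y.2 < z.2 -> False.
Proof.
move=> cc xc yc zc xy yz lxy lyz.
have nxy : x != y by apply: contraTneq lxy => ->; rewrite ltxx.
have nzy : z != y by apply: contraTneq lyz => ->; rewrite ltxx.
have tx := cvx_turn cc yc xc nxy; have tz := cvx_turn cc yc zc nzy.
have tx0 := cvx_turn_ge0 cc yc xc; have tz0 := cvx_turn_ge0 cc yc zc.
case: (eqVneq x (next c y)) tx => [ex _|_ /(_ isT)].
  have : z != next c y by rewrite -ex; apply: contraTneq lyz => ->; rewrite -leNgt ltW.
  by move/tz; rewrite -ex /turn /det /= ; nia.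
case: (eqVneq z (next c y)) tz => [ez _|_ /(_ isT)].
  by rewrite -ez /turn /det /=; nia.
rewrite /turn /det /= xy yz !subrr !mulr0 !subr0; move: lxy lyz; nia.
Qed.

Lemma height_count c (j : int) : cvx c -> (count (fun x => x.1 == j) c <= 2)%N.
Proof.
move=> cc; rewrite -size_filter leqNgt; apply/negP => s3.
have := filter_uniq (fun x : int * int => x.1 == j) (cvx_uniq cc).
have : {in [seq x <- c | x.1 == j], forall x, x \in c /\ x.1 = j}.
  by move=> x; rewrite mem_filter => /andP[/eqP].
case: [seq x <- c | x.1 == j] s3 => [|x [|y [|z s]]] //= _ h /and4P[].
rewrite !inE !negb_or => /and3P[nxy nxz _] /andP[nyz _] _ _.
have [xc xj] := h x (mem_head _ _).
have [|yc yj] := h y; first by rewrite !inE eqxx orbT.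
have [|zc zj] := h z; first by rewrite !inE eqxx !orbT.
have neq (a b : int * int) : a.1 = j -> b.1 = j -> a != b -> a.2 < b.2 \/ b.2 < a.2.
  by move=> aj bj /pair_neq; lia.
have nc a b d := @cvx_noncollinear c a b d cc.
case: (neq x y xj yj nxy) => l1; case: (neq y z yj zj nyz) => l2; case: (neq x z xj zj nxz) => l3.
- by apply: (nc x y z) => //; lia.
- by lia.
- by apply: (nc x z y) => //; lia.
- by apply: (nc z x y) => //; lia.
- by apply: (nc y x z) => //; lia.
- by apply: (nc y z x) => //; lia.
- by lia.
- by apply: (nc z y x) => //; lia.
Qed.

(* The edge vectors [next c u - u] sum to zero, so these sums over [x], added over all edges,
  vanish. *)
Lemma special_edge (c : seq (int * int)) : cvx c ->
  exists2 u : int * int, u \in c & \sum_(x <- c) det (next c u - u) x <= 0.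
Proof.
move=> cc; case: (boolP (has (fun u => \sum_(x <- c) det (next c u - u) x <= 0) c)).
  by case/hasP=> u uc h; exists u.
move=> /hasPn pos; exfalso.
have : \sum_(u <- c) \sum_(x <- c) det (next c u - u) x = 0.
  rewrite exchange_big big1 // => x _.
  have -> : \sum_(u <- c) det (next c u - u) x = \sum_(u <- c) det (next c u) x - \sum_(u <- c)
    det u x.
    by rewrite -sumrB; apply: eq_bigr => u _; rewrite /det /=; ring.
  have -> : \sum_(u <- c) det (next c u) x = \sum_(u <- [seq next c u | u <- c]) det u x
    by rewrite big_map.
  apply/eqP; rewrite subr_eq0; apply/eqP/perm_big.
  apply: uniq_perm; rewrite ?map_inj_uniq ?cvx_uniq //.
    by apply: can_inj (prev_next (cvx_uniq cc)).
  move=> y; apply/mapP/idP => [[z zc ->]|yc]; first by rewrite mem_next.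
  by exists (prev c y); rewrite ?mem_prev // next_prev ?cvx_uniq.
have : c != [::] by case/and3P: cc.
case: c {cc} pos => // a c pos _; rewrite big_cons => e.
have h1 := pos a (mem_head _ _).
have h2 : 0 <= \sum_(u <- c) \sum_(x <- a :: c) det (next (a :: c) u - u) x.
  rewrite big_seq sumr_ge0 // => u uc; rewrite ltW // ltNge; apply: pos.
  by rewrite inE uc orbT.
by move: h1; rewrite -ltNge => /ltr_pwDl/(_ h2); rewrite e ltxx.
Qed.

(* Pairs of rows stand for 2 x 2 integer matrices, acting on row vectors from the right. *)
Definition act (M : (int * int) * (int * int)) (x : int * int) : int * int :=
  (x.1 * M.1.1 + x.2 * M.2.1, x.1 * M.1.2 + x.2 * M.2.2).

Definition mdet (M : (int * int) * (int * int)) : int := det M.1 M.2.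

Definition mmul (M N : (int * int) * (int * int)) := (act N M.1, act N M.2).

Lemma act_mmul M N x : act (mmul M N) x = act N (act M x).
Proof. by rewrite /act /=; congr (_, _); ring. Qed.

Lemma actB M x y : act M (x - y) = act M x - act M y.
Proof. by rewrite {1}/act; apply: (f_equal2 pair); rewrite /=; ring. Qed.

Lemma det_act M x y : det (act M x) (act M y) = mdet M * det x y.
Proof. by rewrite /mdet /det /act /=; ring. Qed.

Lemma turn_act M x y z : turn (act M x) (act M y) (act M z) = mdet M * turn x y z.
Proof. by rewrite /turn -!actB det_act. Qed.

Lemma mdet_mmul M N : mdet (mmul M N) = mdet N * mdet M.
Proof. by rewrite /mdet det_act. Qed.

(** The adjugate multiplied by the determinant instead of divided by it, which agrees for
    determinant 1 or -1. *)
Definition minv (M : (int * int) * (int * int)) : (int * int) * (int * int) :=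
  ((mdet M * M.2.2, - (mdet M * M.1.2)), (- (mdet M * M.2.1), mdet M * M.1.1)).

Lemma act_minv M x : mdet M ^+ 2 = 1 -> act (minv M) (act M x) = x.
Proof.
move=> d1; rewrite [RHS]surjective_pairing -[x.1]mul1r -[x.2]mul1r -d1.
by rewrite /act /minv /mdet /det /=; congr (_, _); ring.
Qed.

Lemma act_inj M : mdet M ^+ 2 = 1 -> injective (act M).
Proof. by move=> d1; apply: can_inj (fun x => act_minv x d1). Qed.

(** Determinant -1 would turn the cycle clockwise. *)
Lemma cvx_act M c : mdet M = 1 -> cvx c -> cvx [seq act M x | x <- c].
Proof.
move=> d1 cc; have inj : injective (act M) by apply: act_inj; rewrite d1.
case/and3P: cc => uc c0 /allP h; apply/and3P; split.
- by rewrite map_inj_uniq.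
- by case: (c) c0.
apply/allP => _ /mapP[u uc' ->]; have /andP[h1 /allP h2] := h u uc'.
rewrite next_map // det_act d1 mul1r h1 /=; apply/allP => _ /mapP[x /h2 h3 ->].
by rewrite turn_act d1 mul1r !(inj_eq inj).
Qed.

Lemma lows_act M c : mdet M = 1 -> uniq c -> lows c -> lows [seq act M x | x <- c].
Proof.
move=> d1 uc /allP h; have inj : injective (act M) by apply: act_inj; rewrite d1.
apply/allP => _ /mapP[u uc' ->]; rewrite next_map //.
have /andP[k1 k2] := h u uc'; rewrite /low det_act d1 mul1r.
have e1 : 2 * ((act M (next c u)).1 - (act M u).1) = M.1.1 * (2 * ((next c u).1 - u.1)) + M.2.1 *
  (2 * ((next c u).2 - u.2)).
  by rewrite /act /=; ring.
have e2 : 2 * ((act M (next c u)).2 - (act M u).2) = M.1.2 * (2 * ((next c u).1 - u.1)) + M.2.2 *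
  (2 * ((next c u).2 - u.2)).
  by rewrite /act /=; ring.
by rewrite e1 e2; apply/andP; split; apply: rpredD; apply: dvdz_mull.
Qed.

(** * Primitive vectors and the two normal forms of an edge *)

Definition prim (x : int * int) : bool := coprimez x.1 x.2.

Lemma primP x : reflect (exists y : int * int, det x y = 1) (prim x).
Proof.
apply: (iffP (coprimezP _ _)) => [[[s t] /= e]|[y e]].
  by exists (- t, s); rewrite -e /det /=; ring.
by exists (y.2, - y.1); rewrite -e /det /=; ring.
Qed.

Lemma prim_act M x : mdet M ^+ 2 = 1 -> prim x -> prim (act M x).
Proof.
move=> d1 /primP[y e]; apply/primP; exists (act M (mdet M * y.1, mdet M * y.2)).
rewrite det_act /=; have -> : det x (mdet M * y.1,
  mdet M * y.2) = mdet M * det x y by rewrite /det /=; ring.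
by rewrite e mulr1 -expr2.
Qed.

Lemma cvx_rot i c : cvx c -> cvx (rot i c).
Proof.
move=> cc; have uc := cvx_uniq cc; apply/and3P; split.
- by rewrite rot_uniq.
- by case/and3P: cc => _; rewrite -!size_eq0 size_rot.
apply/allP => u; rewrite mem_rot next_rot // => uc'.
rewrite cvx_det //=; apply/allP => x; rewrite mem_rot => xc.
case: eqVneq => //= n1; case: eqVneq => //= n2; exact: cvx_turn.
Qed.

Lemma lows_rot i c : uniq c -> lows c -> lows (rot i c).
Proof.
move=> uc /allP h; apply/allP => u; rewrite mem_rot next_rot //; exact: h.
Qed.

(* In both normal forms the first coordinate is the height above the edge, which has local index 1
   in the first case and 2 in the second one. *)
Lemma normal_edge u v : prim u -> prim v -> 0 < det u v -> low u v ->
  exists M (k : nat), [/\ mdet M = 1, (0 < k)%N &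
    (act M u = (1, 0) /\ act M v = (1, k%:Z)) \/
    (act M u = (2, -1) /\ act M v = (2, k%:Z * 2 - 1))].
Proof.
move=> /primP[w e] pv d0 lv.
(* Coordinates in the lattice basis [u], [w]. *)
pose M1 : (int * int) * (int * int) := ((w.2, - u.2), (- w.1, u.1)).
have dM1 : mdet M1 = 1 by rewrite -e /mdet /det /=; ring.
have M1u : act M1 u = (1, 0) by rewrite -e /act /det /=; congr (_, _); ring.
have M1v : act M1 v = (det v w, det u v) by rewrite /act /det /=; congr (_, _); ring.
have d1 : (det u v %| 2 * (det v w - 1))%Z.
  have -> : 2 * (det v w - 1) = w.2 * (2 * (v.1 - u.1)) - w.1 * (2 * (v.2 - u.2)).
    by rewrite -e /det /=; ring.
  by case/andP: lv => h1 h2; apply: rpredB; apply: dvdz_mull.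
have pv1 : prim (det v w, det u v) by rewrite -M1v; apply: prim_act => //; rewrite dM1.
move: d0 d1 pv1 M1v; move: (det u v) (det v w) => d p d0 /dvdzP[q qe] /primP[y ye] M1v.
pose sh (j : int) : (int * int) * (int * int) := ((1, 0), (- j, 1)).
(* Here [2 * (p - 1) = q * d]. For even [q] a shear takes [(p, d)] to [(1, d)], and the local index
   is 1. For odd [q] it leads to [(1 + m, 2 * m)] with [d = 2 * m], and the local index is 2. *)
case: (boolP (2 %| q)%Z) => [/dvdzP[j je]|odq].
  exists (mmul M1 (sh j)), `|d|%N.
  rewrite mdet_mmul dM1 act_mmul act_mmul M1u M1v; split.
  - by rewrite /mdet /det /=; ring.
  - by lia.
  - left; rewrite /act /=; split; congr (_, _); nia.
have [j je] : exists j, q = 2 * j + 1 by exists (q %/ 2)%Z; lia.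
have [m me] : exists m, d = 2 * m by exists (p - 1 - j * d); move: qe; rewrite je; nia.
have pe : p = 1 + m + j * d by move: qe; rewrite je me; nia.
(* For odd [m] both coordinates of [(1 + m, 2 * m)] would be even, although [v] is primitive. *)
have [k ke] : exists k, m = 2 * k.
  exists (m %/ 2)%Z; suff : (2 %| m)%Z by lia.
  apply/negPn/negP => om; have [n ne] : exists n, m = 2 * n + 1 by exists (m %/ 2)%Z; lia.
  by move: ye; rewrite /det /= pe me ne; nia.
exists (mmul (mmul M1 (sh j)) ((2, -1), (-1, 1))), `|k|%N.
rewrite !mdet_mmul dM1 !act_mmul M1u M1v; split.
- by rewrite /mdet /det /=; ring.
- by lia.
- right; rewrite /act /= pe me ke; split; congr (_, _); nia.
Qed.

Lemma next_cat (T : eqType) (s t : seq T) (v : T) :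
  uniq (s ++ v :: t) -> next (s ++ v :: t) v = head v (t ++ s).
Proof.
move=> uc; rewrite -(next_rot (size s) uc) rot_size_cat /=.
by case: (t ++ s) => /= [|w r]; rewrite eqxx.
Qed.

Lemma normalize (c : seq (int * int)) : cvx c -> lows c -> all prim c ->
  exists (M : (int * int) * (int * int)) (i k : nat) (r : seq (int * int)),
  [/\ mdet M = 1, (0 < k)%N, 0 <= \sum_(x <- rot i [seq act M x | x <- c]) x.1 &
    rot i [seq act M x | x <- c] = (1, 0) :: (1, k%:Z) :: r \/
    rot i [seq act M x | x <- c] = (2, -1) :: (2, k%:Z * 2 - 1) :: r].
Proof.
move=> cc lc pc; have [u uc sum0] := special_edge cc.
have vc : next c u \in c by rewrite mem_next.
have [||||M [k [d1 k0 uv]]] := @normal_edge u (next c u).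
- exact: (allP pc).
- exact: (allP pc).
- exact: cvx_det.
- exact: (allP lc).
have [i s e] := rot_to uc.
have [r er] : exists r, rot i c = u :: next c u :: r.
  have := cvx_det cc uc.
  rewrite -(next_rot i (cvx_uniq cc)) e.
  case: (s) => [|w r] /=; rewrite eqxx; last by exists r.
  by rewrite /det; lia.
have e' : rot i [seq act M x | x <- c] = act M u :: act M (next c u) :: [seq act M x | x <- r].
  by rewrite -map_rot er.
exists M, i, k, [seq act M x | x <- r]; split=> //; last first.
  by case: uv => [[e1 e2]|[e1 e2]]; rewrite e' e1 e2; [left|right].
have -> : \sum_(x <- rot i [seq act M x | x <- c]) x.1 = \sum_(x <- c) (act M x).1.
  by rewrite (perm_big _ (permEl (perm_rot _ _))) big_map.
(* The transformed edge points straight up, so each determinant is a fixed negative multiple of the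
   height. *)
have : \sum_(x <- c) det (act M (next c u) - act M u) (act M x) <= 0.
  by rewrite -actB; under eq_bigr => x _ do rewrite det_act d1 mul1r.
case: uv => [[-> ->]|[-> ->]].
  under eq_bigr => x _ do (have -> : forall y : int * int, det ((1, k%:Z) - (1,
    0)) y = - k%:Z * y.1 by move=> y; rewrite /det /=; ring).
  by rewrite -mulr_sumr mulNr oppr_le0 pmulr_rge0.
under eq_bigr => x _ do (have -> : forall y : int * int, det ((2, k%:Z * 2 - 1) - (2,
  -1)) y = - (k%:Z * 2) * y.1 by move=> y; rewrite /det /=; ring).
by rewrite -mulr_sumr mulNr oppr_le0 pmulr_rge0 // mulr_gt0.
Qed.

(* Primitive points with first coordinate in [-m, n - m) and second coordinate in [-6, 6]. *)
Definition box (m n : nat) : seq (int * int) :=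
  [seq p <- [seq (i%:Z - m%:Z, j%:Z - 6) | i <- iota 0 n, j <- iota 0 13] | prim p].

Lemma mem_box (m n : nat) (p : int * int) : prim p ->
  - m%:Z <= p.1 -> p.1 < n%:Z - m%:Z -> -6 <= p.2 -> p.2 <= 6 -> p \in box m n.
Proof.
move=> pp h1 h2 h3 h4; rewrite mem_filter pp andTb.
have -> : p = ((absz (p.1 + m%:Z))%:Z - m%:Z, (absz (p.2 + 6))%:Z - 6).
  by rewrite [LHS]surjective_pairing; congr (_, _); lia.
by apply: (allpairs_f (fun i j : nat => (i%:Z - m%:Z, j%:Z - 6))); rewrite mem_iota; lia.
Qed.

Lemma sum_indicator (T : eqType) (c : seq T) (P : pred T) :
  \sum_(x <- c) (P x)%:Z = (count P c)%:Z.
Proof. by elim: c => [|x c IH]; rewrite ?big_nil // big_cons IH /= PoszD. Qed.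

Lemma sum_mem (T : eqType) (c : seq T) (z : T) (a : int) : uniq c -> z \in c ->
  \sum_(x <- c) a * (x == z)%:Z = a.
Proof.
move=> uc zc; rewrite -mulr_sumr (sum_indicator _ (fun x => x == z)).
by rewrite (count_uniq_mem z uc) zc mulr1.
Qed.

(** * Coordinate bounds in the two normal forms *)

Lemma prim_axis (p : int * int) : prim p -> p.1 = 0 -> -1 <= p.2 <= 1.
Proof.
case/primP=> y; rewrite /det => + p0; rewrite p0 mul0r sub0r => e.
have : (p.2 %| 1)%Z by apply/dvdzP; exists (- y.1); rewrite mulNr mulrC.
by rewrite dvdz1; lia.
Qed.

Lemma cvx_height (c r : seq (int * int)) (u v x : int * int) : cvx c -> c = u :: v :: r ->
  u.1 = v.1 -> 0 < u.1 -> x \in r -> [/\ x \in c, x != u, x != v & x.1 < u.1].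
Proof.
move=> cc ec e0 u0 xr.
have uc : u \in c by rewrite ec mem_head.
have xc : x \in c by rewrite ec !inE xr !orbT.
have nu : next c u = v by rewrite ec /= eqxx.
have := cvx_uniq cc; rewrite {1}ec /= inE negb_or => /and3P[/andP[uv ur] vr _].
have nxu : x != u by apply: contraNneq ur => <-.
have nxv : x != v by apply: contraNneq vr => <-.
split=> //.
have := cvx_turn cc uc xc nxu; rewrite nu => /(_ nxv).
have := cvx_det cc uc; rewrite nu /turn /det /= -e0 subrr mul0r sub0r => h1 h2.
have h3 : u.2 < v.2 by nia.
by move: h2; rewrite oppr_gt0 pmulr_rlt0 ?subr_gt0 ?subr_lt0.
Qed.

(** The majorant [b] keeps the heights of [u], [v] and [z] and replaces all others by 0, so it fails
    only at heights strictly between 0 and [u.1]. For [u.1 = 1] there are none, and [0 <= 2 + z.1];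
    for [u.1 = 2] at most two vertices have height 1, and [0 <= 4 + 2 + z.1]. *)
Lemma lowest_height (c r : seq (int * int)) (u v z : int * int) : cvx c -> c = u :: v :: r ->
  u.1 = v.1 -> 0 < u.1 -> 0 <= \sum_(x <- c) x.1 -> z \in c -> z.1 < 0 ->
  (u.1 = 1 -> -2 <= z.1) /\ (u.1 = 2 -> -6 <= z.1).
Proof.
move=> cc ec e0 u0 s0 zc z0; have uc := cvx_uniq cc.
have uin : u \in c by rewrite ec mem_head.
have vin : v \in c by rewrite ec inE mem_head orbT.
pose b (x : int * int) : int := u.1 * (x == u)%:Z + u.1 * (x == v)%:Z + z.1 * (x == z)%:Z.
have bs : \sum_(x <- c) b x = u.1 + u.1 + z.1 by rewrite /b !big_split /= !sum_mem.
have key (x : int * int) : x \in c -> x.1 <= b x \/ 0 < x.1 < u.1 /\ b x = 0.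
  move=> xc; have zu : z != u by apply: contraTneq z0 => ->; lia.
  have zv : z != v by apply: contraTneq z0 => ->; lia.
  have uv : v != u by have := uc; rewrite ec /= inE negb_or eq_sym => /andP[/andP[]].
  rewrite /b; case: (eqVneq x u) => [->|nxu].
    by rewrite !(eq_sym u) (negPf uv) (negPf zu) /= mulr1 !mulr0 !addr0; left.
  case: (eqVneq x v) => [->|nxv];
    first by rewrite eq_sym (negPf zv) /= mulr1 !mulr0 add0r addr0 e0; left.
  have xr : x \in r by move: xc; rewrite ec !inE (negPf nxu) (negPf nxv).
  have [_ _ _ hx] := cvx_height cc ec e0 u0 xr.
  rewrite /= !mulr0 !add0r; case: eqVneq => [->|_]; first by rewrite mulr1; left.
  by rewrite mulr0; case: (lerP x.1 0) => x0; [left|right; rewrite hx].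
split=> u1.
  suff : \sum_(x <- c) x.1 <= \sum_(x <- c) b x by move=> /(le_trans s0); rewrite bs u1; lia.
  by rewrite big_seq [X in _ <= X]big_seq ler_sum // => x /key[//|[/andP[] + + _]]; rewrite u1; lia.
pose n := count (fun x : int * int => x.1 == 1) c.
have h1 : (n <= 2)%N := height_count 1 cc.
have e : \sum_(x <- c) (b x + (x.1 == 1)%:Z) = u.1 + u.1 + z.1 + n%:Z.
  by rewrite big_split /= bs (sum_indicator c (fun x => x.1 == 1)).
suff : \sum_(x <- c) x.1 <= \sum_(x <- c) (b x + (x.1 == 1)%:Z).
  by move=> /(le_trans s0); rewrite e; move: n h1 {e}; rewrite u1; lia.
rewrite big_seq [X in _ <= X]big_seq ler_sum // => x /key[h|[/andP[h2 h3] ->]].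
  by apply: (le_trans h); rewrite lerDl.
rewrite u1 in h3; move: h2 h3; case: x => p q /= h2 h3.
by have -> : p = 1 by lia.
Qed.

(** For a vertex [z] of negative height, [height_bound] with both ends of the edge gives
    [- z.1 * k <= 4 * (1 - z.1)], hence [k <= 8]; the first end alone gives
    [|z.2| <= 2 * (1 - z.1) <= 6]. *)
Lemma bounds_height1 (c r : seq (int * int)) (k : nat) : cvx c -> lows c -> all prim c ->
  c = (1, 0) :: (1, k%:Z) :: r -> (0 < k)%N -> 0 <= \sum_(x <- c) x.1 ->
  (k <= 8)%N /\ {subset r <= box 2 3}.
Proof.
move=> cc lc pc ec k0 s0.
have uc : (1, 0) \in c by rewrite ec mem_head.
have vc : (1, k%:Z) \in c by rewrite ec inE mem_head orbT.
have neg (z : int * int) : z \in c -> z.1 < 0 -> [/\ -2 <= z.1, -6 <= z.2 <= 6 & (k <= 8)%N].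
  move=> zc z0; have [h _] := lowest_height cc ec erefl isT s0 zc z0.
  have {}h := h erefl.
  have := height_bound cc lc uc zc isT z0; have := height_bound cc lc vc zc isT z0.
  have : z.1 = -1 \/ z.1 = -2 by lia.
  by case=> -> /= b1 b2; split; lia.
have [z zc z0] := cvx_neg cc; have [_ _ k8] := neg z zc z0.
split=> // -[a b] xr; have [xc _ _ /= a1] := cvx_height cc ec erefl isT xr.
have px : prim (a, b) by exact: (allP pc).
have [h1 h2] : -2 <= a /\ -6 <= b <= 6.
  case: (ltP a 0) => [/(neg _ xc)[]|a0] //; have a00 : a = 0 by lia.
  by have /= := prim_axis px a00; lia.
by apply: mem_box => //=; lia.
Qed.

(** Here [- z.1 * (2 * k) <= 4 * (2 - z.1)], hence [k <= 6]. The widest case is a vertex [(1, b)]: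
    compared with a vertex [z] of negative height it satisfies [|b| <= 5 / 2 + 4 / |z.1|], hence
    [|b| <= 6]. *)
Lemma bounds_height2 (c r : seq (int * int)) (k : nat) : cvx c -> lows c -> all prim c ->
  c = (2, -1) :: (2, k%:Z * 2 - 1) :: r -> (0 < k)%N -> 0 <= \sum_(x <- c) x.1 ->
  (k <= 6)%N /\ {subset r <= box 6 8}.
Proof.
move=> cc lc pc ec k0 s0.
have uc : (2, -1) \in c by rewrite ec mem_head.
have vc : (2, k%:Z * 2 - 1) \in c by rewrite ec inE mem_head orbT.
have neg (z : int * int) : z \in c -> z.1 < 0 -> [/\ -6 <= z.1,
  z.1 - 4 <= 2 * z.2 <= 4 - z.1 & (k <= 6)%N].
  move=> zc z0; have [_ h] := lowest_height cc ec erefl isT s0 zc z0.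
  have {}h := h erefl.
  have := height_bound cc lc uc zc isT z0; have := height_bound cc lc vc zc isT z0.
  have : z.1 = -1 \/ z.1 = -2 \/ z.1 = -3 \/ z.1 = -4 \/ z.1 = -5 \/ z.1 = -6 by lia.
  by case=> [->|[->|[->|[->|[->|->]]]]] /= b1 b2; split; lia.
have [z zc z0] := cvx_neg cc; have [z6 zy k6] := neg z zc z0.
split=> // -[a b] xr; have [xc _ _ /= a1] := cvx_height cc ec erefl isT xr.
have px : prim (a, b) by exact: (allP pc).
have [h1 h2] : -6 <= a /\ -6 <= b <= 6.
  case: (ltP a 0) => [/(neg _ xc)[/= h1 h2 _]|a0]; first by split; lia.
  have [a00|a11] : a = 0 \/ a = 1 by lia.
    by have /= := prim_axis px a00; lia.
  have := @height_bound c (a, b) z cc lc xc zc; rewrite /= a11 => /(_ isT z0).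
  have z6' : z.1 = -1 \/ z.1 = -2 \/ z.1 = -3 \/ z.1 = -4 \/ z.1 = -5 \/ z.1 = -6 by lia.
  clear -z6' zy; move: z6' zy => [->|[->|[->|[->|[->|->]]]]] h1 h2; split; lia.
by apply: mem_box => //=; lia.
Qed.

(** * Enumeration *)

(* The path built so far runs from [v0] to its last point [v]; [acc] lists its other points,
   latest first.  The argument [n] is fuel. *)
Fixpoint search (n : nat) (B : seq (int * int)) (v0 v : int * int) (acc : seq (int * int)) :
    seq (seq (int * int)) :=
  if n is n'.+1 then
    (if [&& 0 < det v v0, low v v0 & all (fun x =>
      0 < turn v v0 x) (behead (rev acc))] then [:: rev (v :: acc)] else [::]) ++
    flatten [seq search n' B v0 w (v :: acc) | w <- B &
      [&& w \notin v :: acc, 0 < det v w, low v w & all (fun x => 0 < turn v w x) acc]]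
  else [::].

(** Induction on the unvisited part [r] of the cycle: every pruning test is an instance of [cvx] or
    [lows] at the edge leaving [v]. *)
Lemma searchP (r B acc : seq (int * int)) (v0 v : int * int) (n : nat) :
  let c := v0 :: rev acc ++ v :: r in
  cvx c -> lows c -> {subset r <= B} -> (size r < n)%N -> c \in search n B v0 v (rcons acc v0).
Proof.
elim: r acc v n => [|w r IH] acc v [|n] //= cc lc sr sn; rewrite (@mem_cat (seq (int * int)));
  apply/orP.
  left; rewrite rev_rcons /=.
  have nv : next (v0 :: rev acc ++ [:: v]) v = v0.
    by rewrite -cat_cons next_cat // cvx_uniq.
  have vc : v \in v0 :: rev acc ++ [:: v] by rewrite -cat_cons mem_cat mem_head orbT.
  have := allP lc v vc; have := cvx_det cc vc; rewrite nv => -> -> /=.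
  have -> : all (fun x => 0 < turn v v0 x) (rev acc).
    apply/allP => x xa.
    have := cvx_uniq cc; rewrite /= cat_uniq mem_cat negb_or => /and3P[/andP[v0a _] _ /andP[va _]].
    have xc : x \in v0 :: rev acc ++ [:: v] by rewrite inE mem_cat xa orbT.
    have := cvx_turn cc vc xc; rewrite nv; apply.
      by apply: contraTneq xa => ->; move: va; rewrite /= orbF.
    by apply: contraTneq xa => ->.
  by rewrite rev_cons rev_rcons cats1 mem_head.
right; apply/flattenP; exists (search n B v0 w (v :: rcons acc v0)); last first.
  have := IH (v :: acc) w n; rewrite rev_cons cat_rcons; apply=> //.
  by move=> x xr; apply: sr; rewrite inE xr orbT.
apply: (map_f (fun w => search n B v0 w (v :: rcons acc v0))).
have uc := cvx_uniq cc.
have vc : v \in v0 :: rev acc ++ v :: w :: r by rewrite -cat_cons mem_cat mem_head orbT.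
have nv : next (v0 :: rev acc ++ v :: w :: r) v = w.
  by rewrite -cat_cons next_cat.
rewrite mem_filter sr ?mem_head // andbT.
have lvw := allP lc v vc; have dvw := cvx_det cc vc; rewrite nv in lvw dvw; rewrite lvw dvw /=.
have key x : x \in rcons acc v0 -> [/\ x \in v0 :: rev acc ++ v :: w :: r, x != v & x != w].
  rewrite mem_rcons => xa.
  have xb : x \in v0 :: rev acc by move: xa; rewrite !inE mem_rev.
  split; first by rewrite -cat_cons mem_cat xb.
    apply/eqP => e; move: uc; rewrite -cat_cons cat_uniq => /and3P[_ /hasP[]].
    by exists v; rewrite ?mem_head // -e.
  apply/eqP => e; move: uc; rewrite -cat_cons cat_uniq => /and3P[_ /hasP[]].
  by exists w; rewrite ?inE ?eqxx ?orbT // -e.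
apply/andP; split.
  rewrite inE negb_or; apply/andP; split; last by apply/negP => /key[_ _]; rewrite eqxx.
  move: uc; rewrite -cat_cons cat_uniq => /and3P[_ _ /=]; rewrite inE negb_or eq_sym.
  by case/andP=> /andP[].
by apply/allP => x /key[xc xv xw]; have := cvx_turn cc vc xc xv; rewrite nv => /(_ xw).
Qed.

Definition eidx (u v : int * int) : nat := `|(det u v %/ gcdz (v.1 - u.1) (v.2 - u.2))%Z|%N.

(** Written with [foldr] so that it evaluates on concrete cycles. *)
Definition cidx (c : seq (int * int)) : nat := foldr lcmn 1%N [seq eidx u (next c u) | u <- c].

Definition unim (M : (int * int) * (int * int)) : bool := mdet M ^+ 2 == 1.

(* By Cramer's rule, these are the only matrices that can map two consecutive points of [c] to a
   given pair of points of [t]. *)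
Definition candidates (c t : seq (int * int)) : seq ((int * int) * (int * int)) :=
  let u := head (0, 0) c in let v := next c u in let d := det u v in
  [seq ((((v.2 * p.1 - u.2 * q.1) %/ d)%Z, ((v.2 * p.2 - u.2 * q.2) %/ d)%Z),
        (((u.1 * q.1 - v.1 * p.1) %/ d)%Z, ((u.1 * q.2 - v.1 * p.2) %/ d)%Z)) | p <- t, q <- t].

(** For an unsuitable pair of images the rounded quotients form an arbitrary integer matrix, so each
    candidate is tested in full. *)
Definition equivb (c t : seq (int * int)) : bool :=
  has (fun M => [&& unim M, all (fun x => act M x \in t) c &
                 all (fun y => y \in [seq act M x | x <- c]) t]) (candidates c t).

(** Comparing sets of points ignores starting point and orientation, so determinant -1 is allowed
    here. *)
Definition equiv (c t : seq (int * int)) : Prop :=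
  exists M, mdet M ^+ 2 = 1 /\ [seq act M x | x <- c] =i t.

Lemma equivP (c t : seq (int * int)) : cvx c -> reflect (equiv c t) (equivb c t).
Proof.
move=> cc; apply: (iffP hasP) => [[M _ /and3P[/eqP d1 /allP h1 /allP h2]]|[M [d1 h]]].
  exists M; split=> // y; apply/idP/idP; last exact: h2.
  by case/mapP=> x xc ->; apply: h1.
exists M; last first.
  rewrite /unim d1 eqxx /=; apply/andP; split; apply/allP => x xc; last by rewrite h.
  by rewrite -h map_f.
have uc : head (0, 0) c \in c by case/and3P: cc => _; case: (c) => //= u s _ _; rewrite mem_head.
rewrite /candidates; move: (head _ _) uc => u uc.
have vc : next c u \in c by rewrite mem_next.
have := cvx_det cc uc; move: (next c u) vc => v vc d0.
pose f (p q : int * int) := ((((v.2 * p.1 - u.2 * q.1) %/ det u v)%Z,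
  ((v.2 * p.2 - u.2 * q.2) %/ det u v)%Z),
        (((u.1 * q.1 - v.1 * p.1) %/ det u v)%Z, ((u.1 * q.2 - v.1 * p.2) %/ det u v)%Z)).
have -> : M = f (act M u) (act M v).
  case: M {d1 h} => [[a b] [a' b']]; rewrite /f /act /=.
  have e1 : v.2 * (u.1 * a + u.2 * a') - u.2 * (v.1 * a + v.2 * a') = a * det u v
    by rewrite /det; ring.
  have e2 : v.2 * (u.1 * b + u.2 * b') - u.2 * (v.1 * b + v.2 * b') = b * det u v
    by rewrite /det; ring.
  have e3 : u.1 * (v.1 * a + v.2 * a') - v.1 * (u.1 * a + u.2 * a') = a' * det u v
    by rewrite /det; ring.
  have e4 : u.1 * (v.1 * b + v.2 * b') - v.1 * (u.1 * b + u.2 * b') = b' * det u v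
    by rewrite /det; ring.
  by rewrite e1 e2 e3 e4 !mulzK // gt_eqF.
by apply: (allpairs_f f); rewrite -h map_f.
Qed.

(** Seven triangles, seventeen quadrilaterals and six pentagons. *)
Definition table : seq (seq (int * int)) := [::
  [:: (1, 0); (0, 1); (-8, -3)];
  [:: (1, 0); (0, 1); (-5, -4)];
  [:: (1, 0); (0, 1); (-4, -1)];
  [:: (1, 0); (1, 2); (-5, -6)];
  [:: (1, 0); (1, 3); (-5, -12)];
  [:: (1, 0); (1, 4); (-3, -8)];
  [:: (1, 0); (1, 8); (-1, -4)];
  [:: (1, 0); (0, 1); (-8, 5); (1, -1)];
  [:: (1, 0); (0, 1); (-5, 1); (1, -1)];
  [:: (1, 0); (0, 1); (-4, -3); (0, -1)];
  [:: (1, 0); (0, 1); (-4, -1); (-3, -1)];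
  [:: (1, 0); (0, 1); (-4, -1); (-2, -1)];
  [:: (1, 0); (0, 1); (-4, -1); (-1, -1)];
  [:: (1, 0); (0, 1); (-4, -1); (0, -1)];
  [:: (1, 0); (0, 1); (-4, 3); (1, -2)];
  [:: (1, 0); (0, 1); (-4, 3); (3, -4)];
  [:: (1, 0); (0, 1); (-3, -2); (-1, -2)];
  [:: (1, 0); (0, 1); (-3, -2); (1, -2)];
  [:: (1, 0); (0, 1); (-3, 1); (1, -3)];
  [:: (1, 0); (1, 2); (-3, -2); (-1, -2)];
  [:: (1, 0); (1, 2); (-2, -1); (-2, -3)];
  [:: (1, 0); (1, 2); (-1, 2); (-1, -4)];
  [:: (1, 0); (1, 3); (-1, 1); (-1, -4)];
  [:: (1, 0); (1, 4); (-1, 0); (-1, -4)];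
  [:: (1, 0); (0, 1); (-4, 1); (0, -1); (1, -1)];
  [:: (1, 0); (0, 1); (-4, 3); (-3, 2); (1, -1)];
  [:: (1, 0); (0, 1); (-4, 3); (-2, 1); (1, -1)];
  [:: (1, 0); (0, 1); (-4, 3); (-1, 0); (1, -1)];
  [:: (1, 0); (0, 1); (-3, 1); (-1, -1); (1, -1)];
  [:: (1, 0); (0, 1); (-2, 1); (-2, -1); (0, -1)]].

Lemma table_polygons : all (fun t => [&& cvx t, all prim t & cidx t == 2%N]) table.
Proof. by vm_compute. Qed.

Lemma table_inequiv : pairwise (fun s t => ~~ equivb s t) table.
Proof. by vm_compute. Qed.

Definition found : seq (seq (int * int)) :=
  flatten [seq search 100 (box 2 3) (1, 0) (1, k%:Z) [:: (1, 0)] | k <- iota 1 8] ++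
  flatten [seq search 100 (box 6 8) (2, -1) (2, k%:Z * 2 - 1) [:: (2, -1)] | k <- iota 1 6].

Lemma found_in_table :
  all (fun c => (cidx c == 2%N) ==> has (equivb c) table) found.
Proof. by vm_compute. Qed.

Lemma size_table : size table = 30%N.
Proof. by []. Qed.

Lemma size_boxes : (size (box 2 3) < 100)%N && (size (box 6 8) < 100)%N.
Proof. by vm_compute. Qed.

(** * Invariance of the index and classification of vertex cycles *)

Lemma search_start (r B : seq (int * int)) (v0 v : int * int) (n : nat) :
  cvx (v0 :: v :: r) -> lows (v0 :: v :: r) -> {subset r <= B} -> (size r < n)%N ->
  v0 :: v :: r \in search n B v0 v [:: v0].
Proof. exact: (@searchP r B [::]). Qed.

(** Under any integer matrix the old gcd divides the new one; this is applied to [M] and to its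
    inverse. *)
Lemma gcdz_act M x : mdet M ^+ 2 = 1 -> gcdz (act M x).1 (act M x).2 = gcdz x.1 x.2.
Proof.
move=> d1.
have sub N y : (gcdz y.1 y.2 %| gcdz (act N y).1 (act N y).2)%Z.
  by rewrite dvdz_gcd; apply/andP; split; rewrite rpredD // dvdz_mulr ?dvdz_gcdl ?dvdz_gcdr.
have h := sub (minv M) (act M x); rewrite act_minv // in h.
by apply/eqP; rewrite /gcdz eqz_nat eqn_dvd; apply/andP; split; [apply: h|apply: sub].
Qed.

Lemma eidx_act M u v : mdet M = 1 -> eidx (act M u) (act M v) = eidx u v.
Proof.
move=> d1; have := @gcdz_act M (v - u); rewrite d1 actB => /(_ (expr1n _ _)) h.
by rewrite /eidx det_act d1 mul1r; congr (absz (_ %/ _)%Z).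
Qed.

Lemma cidxE c : cidx c = \big[lcmn/1%N]_(u <- c) eidx u (next c u).
Proof. by rewrite /cidx foldrE big_map. Qed.

Lemma cidx_act M c : mdet M = 1 -> uniq c -> cidx [seq act M x | x <- c] = cidx c.
Proof.
move=> d1 uc; have inj : injective (act M) by apply: act_inj; rewrite d1.
by rewrite !cidxE big_map; apply: eq_bigr => u _; rewrite next_map // eidx_act.
Qed.

Lemma cidx_rot i c : uniq c -> cidx (rot i c) = cidx c.
Proof.
move=> uc; rewrite !cidxE (perm_big _ (permEl (perm_rot _ _))) /=.
by apply: eq_bigr => u _; rewrite next_rot.
Qed.

Lemma low_eidx u v : 0 < det u v -> (eidx u v %| 2)%N -> low u v.
Proof.
rewrite /eidx /low => d0.
have gd : (gcdz (v.1 - u.1)%R (v.2 - u.2)%R %| det u v)%Z.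
  have -> : det u v = u.1 * (v.2 - u.2) - u.2 * (v.1 - u.1) by rewrite /det; ring.
  by rewrite rpredB // dvdz_mull ?dvdz_gcdl ?dvdz_gcdr.
move: (dvdz_gcdl (v.1 - u.1) (v.2 - u.2)) (dvdz_gcdr (v.1 - u.1) (v.2 - u.2)).
move: gd; move: (v.1 - u.1) (v.2 - u.2) => a b; move: (gcdz a b) => g.
case/dvdzP=> q qe ga gb; move: d0; rewrite qe => d0;
  have g0 : g != 0 by apply: contraTneq d0 => ->; rewrite mulr0.
by rewrite mulzK // -(dvdzE q 2) => h; rewrite !dvdz_mul.
Qed.

Lemma found_mem (c : seq (int * int)) : cvx c -> lows c -> all prim c ->
  exists M i, mdet M = 1 /\ rot i [seq act M x | x <- c] \in found.
Proof.
move=> cc lc pc; have [M [i [k [r [d1 k0 s0 ec]]]]] := normalize cc lc pc.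
exists M, i; split=> //; move: ec s0.
have cc' := cvx_rot i (cvx_act d1 cc).
have lc' := lows_rot i (cvx_uniq (cvx_act d1 cc)) (lows_act d1 (cvx_uniq cc) lc).
have pc' : all prim (rot i [seq act M x | x <- c]).
  apply/allP => x; rewrite mem_rot => /mapP[y yc ->].
  by apply: prim_act; [rewrite d1|exact: (allP pc)].
move: (rot i _) cc' lc' pc' => c' cc' lc' pc' ec s0.
have /andP[B1 B2] := size_boxes.
have small B : (size B < 100)%N -> {subset r <= B} -> (size r < 100)%N.
  move=> sB rB; apply: leq_ltn_trans sB; apply: uniq_leq_size rB.
  by have := cvx_uniq cc'; case: ec => -> /and3P[].
rewrite (@mem_cat (seq (int * int))); apply/orP.
case: ec => ec; [left|right].
  have [k8 rB] := bounds_height1 cc' lc' pc' ec k0 s0.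
  apply/flattenP; exists (search 100 (box 2 3) (1, 0) (1, k%:Z) [:: (1, 0)]).
    apply: (map_f (fun k : nat => search 100 (box 2 3) (1, 0) (1, k%:Z) [:: (1, 0)])).
    by rewrite mem_iota k0.
  move: cc' lc'; rewrite ec => cc' lc'.
  exact (search_start cc' lc' rB (small _ B1 rB)).
have [k6 rB] := bounds_height2 cc' lc' pc' ec k0 s0.
apply/flattenP; exists (search 100 (box 6 8) (2, -1) (2, k%:Z * 2 - 1) [:: (2, -1)]).
  apply: (map_f (fun k : nat => search 100 (box 6 8) (2, -1) (2, k%:Z * 2 - 1) [:: (2, -1)])).
  by rewrite mem_iota k0.
move: cc' lc'; rewrite ec => cc' lc'.
  exact (search_start cc' lc' rB (small _ B2 rB)).
Qed.

Lemma dvdn_foldr_lcmn (s : seq nat) (m : nat) : m \in s -> (m %| foldr lcmn 1 s)%N.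
Proof.
elim: s => //= a s IH; rewrite inE => /orP[/eqP ->|/IH]; first exact: dvdn_lcml.
by move=> h; apply: dvdn_trans h (dvdn_lcmr _ _).
Qed.

Lemma classification (c : seq (int * int)) : cvx c -> all prim c -> cidx c = 2%N ->
  exists2 t, t \in table & equiv c t.
Proof.
move=> cc pc ic.
have lc : lows c.
  apply/allP => u uc; apply: low_eidx; first exact: cvx_det.
  by rewrite -ic; apply: dvdn_foldr_lcmn; apply: map_f.
have [M [i [d1 fc]]] := found_mem cc lc pc.
have uM := cvx_uniq (cvx_act d1 cc).
have := allP found_in_table _ fc.
rewrite (cidx_rot i uM) (cidx_act d1 (cvx_uniq cc)) ic eqxx => /hasP[t tt].
case/(equivP _ (cvx_rot i (cvx_act d1 cc))) => N [dN h].
exists t => //; exists (mmul M N); split.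
  by rewrite mdet_mmul exprMn d1 dN mulr1.
move=> y; rewrite -h; apply/mapP/mapP => [[x xc ->]|[z]].
  by exists (act M x); rewrite ?act_mmul // mem_rot map_f.
by rewrite mem_rot => /mapP[x xc ->] ->; exists x; rewrite ?act_mmul.
Qed.

(** * Convex hulls and faces *)

Lemma interior0P (Q : set 'rV[rat]_2) : polygon_interior Q 0 <->
  exists2 e : rat, 0 < e & forall y : 'rV[rat]_2, (forall j, `|y 0 j| < e) -> Q y.
Proof.
rewrite /polygon_interior /interior /=; split=> [/nbhs_ballP[e /= e0 sub]|[e e0 sub]].
  exists e => // y ye; apply: sub; split=> // i j; rewrite mxE /ball /= sub0r normrN ord1.
  exact: ye.
apply/nbhs_ballP; exists e => // y [_ ye]; apply: sub => j.
by have := ye 0 j; rewrite mxE /ball /= sub0r normrN.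
Qed.

Definition pt (x : int * int) : 'rV[int]_2 := \row_j (if j == 0 then x.1 else x.2).

Definition unpt (v : 'rV[int]_2) : int * int := (v 0 0, v 0 1).

Lemma ptK : cancel pt unpt.
Proof. by case=> a b; rewrite /unpt !mxE. Qed.

Lemma row2P (R : Type) (x y : 'rV[R]_2) : x 0 0 = y 0 0 -> x 0 1 = y 0 1 -> x = y.
Proof.
move=> e0 e1; apply/rowP => j.
by case: (eqVneq j 0) => [->//|j0]; have -> : j = 1 by apply/val_inj; case: j j0 => [[|[|]]].
Qed.

Lemma unptK : cancel unpt pt.
Proof. by move=> v; apply: row2P; rewrite !mxE. Qed.

Definition emb (x : int * int) : 'rV[rat]_2 := toQ (pt x).

Lemma emb0 x : emb x 0 0 = x.1%:~R.
Proof. by rewrite !mxE. Qed.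

Lemma emb1 x : emb x 0 1 = x.2%:~R.
Proof. by rewrite !mxE. Qed.

Lemma emb_inj : injective emb.
Proof.
move=> [a b] [c d] e; have := congr1 (fun v : 'rV[rat]_2 => v 0 0) e.
have := congr1 (fun v : 'rV[rat]_2 => v 0 1) e.
by rewrite !emb0 !emb1 /= => /intr_inj -> /intr_inj ->.
Qed.

Lemma pairingE (u : 'cV[rat]_2) (x : 'rV[rat]_2) : pairing u x = x 0 0 * u 0 0 + x 0 1 * u 1 0.
Proof. by rewrite /pairing mxE big_ord_recl big_ord1; congr (_ + x 0 _ * u _ 0);
  apply: val_inj. Qed.

Lemma pairing_linear (u : 'cV[rat]_2) (n : nat) (w : 'I_n -> rat) (x : 'I_n -> 'rV[rat]_2) :
  pairing u (\sum_(i < n) w i *: x i) = \sum_(i < n) w i * pairing u (x i).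
Proof.
by rewrite /pairing mulmx_suml summxE; apply: eq_bigr => i _; rewrite -scalemxAl mxE.
Qed.

Lemma hull_mem (s : seq 'rV[rat]_2) x : x \in s -> convex_hull s x.
Proof.
move=> xs; have ix : (index x s < size s)%N by rewrite index_mem.
exists (fun i => (i == Ordinal ix)%:R); split=> [i||]; first exact: ler0n.
  by rewrite (bigD1 (Ordinal ix)) //= eqxx big1 ?addr0 // => i /negPf ->.
rewrite (bigD1 (Ordinal ix)) //= eqxx big1 ?addr0 ?scale1r ?nth_index //.
by move=> i /negPf ->; rewrite scale0r.
Qed.

Lemma hull_sub (s t : seq 'rV[rat]_2) : (forall x, x \in s -> convex_hull t x) ->
  convex_hull s `<=` convex_hull t.
Proof.
move=> st x [w [w0 w1 ->]].
have /choice[W hW] : forall i : 'I_(size s), exists W : 'I_(size t) -> rat,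
    [/\ forall j, 0 <= W j, \sum_j W j = 1 & s`_i = \sum_j W j *: t`_j].
  by move=> i; have := st s`_i (mem_nth _ (ltn_ord i)).
exists (fun j => \sum_i w i * W i j); split=> [j||].
- by apply: sumr_ge0 => i _; apply: mulr_ge0 => //; have [] := hW i.
- rewrite exchange_big -[RHS]w1; apply: eq_bigr => i _ /=.
  by rewrite -mulr_sumr; have [_ -> _] := hW i; rewrite mulr1.
under [RHS]eq_bigr => j _ do rewrite scaler_suml.
rewrite exchange_big; apply: eq_bigr => i _ /=.
have [_ _ {1}->] := hW i; rewrite scaler_sumr; apply: eq_bigr => j _.
by rewrite scalerA.
Qed.

Lemma hull_comb (s : seq 'rV[rat]_2) (a b c : rat) (x y z : 'rV[rat]_2) :
  convex_hull s x -> convex_hull s y -> convex_hull s z ->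
  0 <= a -> 0 <= b -> 0 <= c -> a + b + c = 1 -> convex_hull s (a *: x + b *: y + c *: z).
Proof.
move=> sx sy sz a0 b0 c0 e; apply: (@hull_sub [:: x; y; z]).
  by move=> v; rewrite !inE => /or3P[] /eqP ->.
exists (fun i : 'I_3 => [:: a; b; c]`_i); split.
- by case=> [[|[|[|]]]].
- by rewrite !big_ord_recl big_ord0 /= addr0 addrA.
- by rewrite !big_ord_recl big_ord0 /= addr0 addrA.
Qed.

Lemma hull_le (s : seq 'rV[rat]_2) (u : 'cV[rat]_2) (m : rat) :
  (forall x, x \in s -> pairing u x <= m) -> forall x, convex_hull s x -> pairing u x <= m.
Proof.
move=> h x [w [w0 w1 ->]]; rewrite pairing_linear -[m]mul1r -w1 mulr_suml.
by apply: ler_sum => i _; apply: ler_wpM2l => //; apply: h; apply: mem_nth.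
Qed.

Lemma hull_max (s : seq 'rV[rat]_2) (u : 'cV[rat]_2) (x : 'rV[rat]_2) : convex_hull s x ->
  exists2 y, y \in s & pairing u x <= pairing u y.
Proof.
move=> sx; apply: contrapT => no.
have s0 : s != [::].
  apply/eqP => e; move: sx; rewrite e => -[w [_ + _]]; rewrite big_ord0 => /eqP.
  by rewrite eq_sym oner_eq0.
have [y ys best] := @seq_best _ (fun y z => pairing u z <= pairing u y) s
  (fun y z _ _ => le_total _ _) (fun y x z _ _ _ h k => le_trans k h) s0.
by apply: no; exists y => //; apply: hull_le sx.
Qed.

(** * Polygons spanned by vertex cycles *)

Definition polygon (c : seq (int * int)) : set 'rV[rat]_2 := convex_hull [seq emb x | x <- c].

Definition cvec (p : int * int) : 'cV[int]_2 := \col_i (if i == 0 then p.1 else p.2).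

(** The edge vector turned clockwise, which points outward for a counterclockwise cycle; it is the
    primitive normal times the lattice length of the edge. *)
Definition normal (u v : int * int) : int * int := (v.2 - u.2, u.1 - v.1).

Lemma pairing_cvec (p : int * int) (x : 'rV[rat]_2) :
  pairing (toQ (cvec p)) x = x 0 0 * p.1%:~R + x 0 1 * p.2%:~R.
Proof. by rewrite pairingE !mxE. Qed.

Lemma pairing_emb (p x : int * int) : pairing (toQ (cvec p)) (emb x) = (dot x p)%:~R.
Proof. by rewrite pairing_cvec emb0 emb1 /dot rmorphD !rmorphM. Qed.

Lemma dot_normal (u v x : int * int) : dot x (normal u v) = det u v - turn u v x.
Proof. by rewrite /dot /normal /turn /det /=; ring. Qed.

Lemma pairingD (u : 'cV[rat]_2) x y : pairing u (x + y) = pairing u x + pairing u y.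
Proof. by rewrite !pairingE !mxE; ring. Qed.

Lemma pairingZ (u : 'cV[rat]_2) a x : pairing u (a *: x) = a * pairing u x.
Proof. by rewrite !pairingE !mxE; ring. Qed.

Lemma pairing0 (u : 'cV[rat]_2) : pairing u 0 = 0.
Proof. by rewrite pairingE !mxE; ring. Qed.

(** The sum [a + b] is the gauge of the polygon at [x]: it is at most 1 exactly on the polygon. *)
Lemma cone_decomposition c (x : 'rV[rat]_2) : cvx c ->
  exists (u : int * int) (a b : rat), [/\ u \in c, 0 <= a, 0 <= b &
    x = a *: emb u + b *: emb (next c u)] /\
    pairing (toQ (cvec (normal u (next c u)))) x = (a + b) * (det u (next c u))%:~R.
Proof.
move=> cc; have [u uc [s1 s2]] := cvx_cone (x 0 0, x 0 1) cc.
have d0 : 0 < (det u (next c u))%:~R :> rat by rewrite ltr0z cvx_det.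
have dn : (det u (next c u))%:~R != 0 :> rat by rewrite gt_eqF.
exists u, (- pdet (next c u) (x 0 0, x 0 1) / (det u (next c u))%:~R),
  (pdet u (x 0 0, x 0 1) / (det u (next c u))%:~R).
have dE : (det u (next c u))%:~R = u.1%:~R * (next c u).2%:~R - u.2%:~R * (next c u).1%:~R :> rat.
  by rewrite /det rmorphB !rmorphM.
split.
  split=> //; [by rewrite divr_ge0 ?oppr_ge0 // ltW|by rewrite divr_ge0 // ltW|].
  by apply: row2P; rewrite !mxE ?emb0 ?emb1 /pdet /=; move: dn; rewrite dE => dn; field.
rewrite mulrDl !divfK // pairing_cvec /normal /pdet /= !rmorphB /=; ring.
Qed.

Lemma polygon_mem c x : x \in c -> polygon c (emb x).
Proof. by move=> xc; apply/hull_mem/map_f. Qed.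

(** For a vertex [z], writing [- z] as [a u + b v] in the cone of an edge gives a positive relation
    [z + a u + b v = 0], to be divided by [1 + a + b]. *)
Lemma polygon_0 c : cvx c -> polygon c 0.
Proof.
move=> cc; have [z zc _] := cvx_neg cc.
have [u [a [b [[uc a0 b0 e] _]]]] := cone_decomposition (- emb z) cc.
have n0 : 1 + a + b != 0 by rewrite gt_eqF // -addrA ltr_pwDl // addr_ge0.
have p0 : 0 <= 1 + a + b by rewrite -addrA addr_ge0 // addr_ge0.
have -> : 0 = (1 / (1 + a + b)) *: emb z + (a / (1 + a + b)) *: emb u + (b / (1 + a + b)) *: emb
  (next c u).
  by rewrite !(mulrC _ (_^-1)) -!scalerA -!scalerDr scale1r -[_ + _ + b *: _]addrA -e addrN scaler0.
have vc : next c u \in c by rewrite mem_next.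
apply: hull_comb; do ?exact: polygon_mem; do ?by rewrite divr_ge0.
by rewrite -!mulrDl divff.
Qed.

(** Conversely, the inequality of the edge whose cone contains [x] gives [a + b <= 1], and the
    remaining weight goes to 0. *)
Lemma polygonP c x : cvx c -> polygon c x <->
  (forall u, u \in c -> pairing (toQ (cvec (normal u (next c u)))) x <= (det u (next c u))%:~R).
Proof.
move=> cc; split=> [px u uc|h].
  apply: hull_le px => _ /mapP[y yc ->].
  by rewrite pairing_emb ler_int dot_normal lerBlDr lerDl cvx_turn_ge0.
have [u [a [b [[uc a0 b0 e] eab]]]] := cone_decomposition x cc.
have vc : next c u \in c by rewrite mem_next.
have ab1 : a + b <= 1.
  have := h u uc; rewrite eab -{2}[(det u _)%:~R]mul1r ler_pM2r // ltr0z; exact: cvx_det.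
have -> : x = a *: emb u + b *: emb (next c u) + (1 - (a + b)) *: 0 by rewrite scaler0 addr0.
apply: hull_comb => //; do ?exact: polygon_mem; do ?exact: polygon_0.
- by rewrite subr_ge0.
- by rewrite addrC subrK.
Qed.

(** The facet inequalities have positive integers on the right, so a box on which all normals are at
    most 1 lies inside the polygon. *)
Lemma small_functionals (s : seq (int * int)) : exists2 e : rat, 0 < e &
  forall p, p \in s -> forall y : 'rV[rat]_2, (forall j, `|y 0 j| < e) ->
    pairing (toQ (cvec p)) y <= 1.
Proof.
elim: s => [|p s [e e0 h]]; first by exists 1.
pose m : rat := 1 + `|p.1%:~R| + `|p.2%:~R|.
have m0 : 0 < m by rewrite /m -addrA ltr_pwDl // addr_ge0.
exists (Num.min e (m^-1)); first by rewrite lt_min e0 invr_gt0.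
move=> q; rewrite inE => /orP[/eqP ->|qs] y ye; last first.
  by apply: h => // j; have := ye j; rewrite lt_min => /andP[].
have y0 : `|y 0 0| < m^-1 by have := ye 0; rewrite lt_min => /andP[].
have y1 : `|y 0 1| < m^-1 by have := ye 1; rewrite lt_min => /andP[].
rewrite pairing_cvec (le_trans (ler_norm _)) // (le_trans (ler_normD _ _)) // !normrM.
apply: (@le_trans _ _ (m^-1 * `|p.1%:~R| + m^-1 * `|p.2%:~R|)).
  by apply: lerD; apply: ler_wpM2r => //; apply: ltW.
by rewrite -mulrDr mulrC ler_pdivrMr // mul1r /m -addrA lerDr.
Qed.

Lemma polygon_interior0 c : cvx c -> polygon_interior (polygon c) 0.
Proof.
move=> cc; apply/interior0P.
have [e e0 h] := small_functionals [seq normal u (next c u) | u <- c].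
exists e => // y ye; apply/polygonP => // u uc.
apply: (le_trans (h _ (map_f (fun u => normal u (next c u)) uc) y ye)).
by rewrite ler1z -gtz0_ge1 cvx_det.
Qed.

Lemma interior_pairing_gt0 Q (g : 'cV[rat]_2) : polygon_interior Q 0 -> g != 0 ->
  exists2 y, Q y & 0 < pairing g y.
Proof.
move=> /interior0P[e e0 h] g0.
pose m : rat := 1 + `|g 0 0| + `|g 1 0|.
have m0 : 0 < m by rewrite /m -addrA ltr_pwDl // addr_ge0.
have em0 : 0 < e / m by rewrite divr_gt0.
exists ((e / m) *: g^T).
  apply: h => j; rewrite !mxE normrM (gtr0_norm em0) mulrAC ltr_pdivrMr // ltr_pM2l //.
  rewrite /m -addrA; case: (eqVneq j 0) => [->|j0].
    by rewrite addrCA ltrDl ltr_pwDl.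
  have -> : j = 1 by apply/val_inj; case: j j0 => [[|[|]]].
  by rewrite addrA ltrDr ltr_pwDl.
rewrite pairingZ mulr_gt0 // pairingE !mxE -!expr2.
rewrite lt_neqAle addr_ge0 ?sqr_ge0 // andbT eq_sym paddr_eq0 ?sqr_ge0 // !sqrf_eq0.
apply: contra g0 => /andP[/eqP g1 /eqP g2]; apply/eqP/matrixP => i j; rewrite ord1 mxE.
by case: (eqVneq i 0) => [->//|i0]; have -> : i = 1 by apply/val_inj; case: i i0 => [[|[|]]].
Qed.

Lemma cvec_inj : injective cvec.
Proof.
move=> [a b] [c d] /matrixP e; have := e 0 0; have := e 1 0.
by rewrite !mxE /= => -> ->.
Qed.

Lemma toQ_inj m n : injective (@toQ m n).
Proof. by move=> A B /matrixP e; apply/matrixP => i j; have := e i j;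
  rewrite !mxE => /intr_inj. Qed.

Lemma toQ_cvec_neq0 p : p != 0 -> toQ (cvec p) != 0.
Proof.
move=> p0; apply: contra p0 => /eqP e; apply/eqP/cvec_inj/toQ_inj; rewrite e.
by apply/matrixP => i j; rewrite !mxE /=; case: ifP.
Qed.

Lemma interior_surrounds (S : seq (int * int)) : polygon_interior (polygon S) 0 -> surrounds S.
Proof.
move=> h e e0; have [|y Qy y0] := interior_pairing_gt0 h (g := toQ (cvec (- e.2, e.1))).
  apply: toQ_cvec_neq0; apply: contra e0; rewrite -!pair_eqE /= /pair_eq /= oppr_eq0.
  by rewrite andbC.
have [_ /mapP[x xS ->]] := hull_max (toQ (cvec (- e.2, e.1))) Qy.
rewrite pairing_emb => /(lt_le_trans y0); rewrite ltr0z => d0; exists x => //.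
by move: d0; rewrite /dot /det /=; lia.
Qed.

(** With [a + b < 1] the value at [z] would stay below [m], as [m] is positive; a convex combination
    attains the maximum only if all points of nonzero weight do. *)
Lemma face_decomposition c (g : 'cV[rat]_2) (m : rat) z : cvx c -> 0 < m ->
  (forall y, polygon c y -> pairing g y <= m) -> polygon c z -> pairing g z = m ->
  exists (u : int * int) (a b : rat), [/\ u \in c, 0 <= a, 0 <= b, a + b = 1 &
    [/\ z = a *: emb u + b *: emb (next c u), a != 0 -> pairing g (emb u) = m &
        b != 0 -> pairing g (emb (next c u)) = m]].
Proof.
move=> cc m0 gm pz gz.
have [u [a [b [[uc a0 b0 e] eab]]]] := cone_decomposition z cc.
have vc : next c u \in c by rewrite mem_next.
have ab1 : a + b <= 1.
  have /polygonP-/(_ cc u uc) := pz.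
  rewrite eab -{2}[(det u _)%:~R]mul1r ler_pM2r // ltr0z; exact: cvx_det.
have gu := gm _ (polygon_mem uc); have gv := gm _ (polygon_mem vc).
exists u, a, b; move: gz; rewrite e pairingD !pairingZ => gz.
have gab : m <= (a + b) * m.
  by rewrite -{1}gz mulrDl lerD // ler_wpM2l.
have ab : a + b = 1.
  by apply/eqP; rewrite eq_le ab1 /= -(ler_pM2r m0) mul1r.
split=> //; split=> // n0; apply/eqP; rewrite eq_le ?gu ?gv /=.
  have a1 : 0 < a by rewrite lt_neqAle eq_sym n0.
  rewrite -(ler_pM2l a1); have : b * pairing g (emb (next c u)) <= b * m by rewrite ler_wpM2l.
  have : (a + b) * m = m by rewrite ab mul1r.
  by rewrite mulrDl; lra.
have b1 : 0 < b by rewrite lt_neqAle eq_sym n0.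
rewrite -(ler_pM2l b1); have : a * pairing g (emb u) <= a * m by rewrite ler_wpM2l.
have : (a + b) * m = m by rewrite ab mul1r.
by rewrite mulrDl; lra.
Qed.

Lemma edge_bound c u y : cvx c -> u \in c -> polygon c y ->
  pairing (toQ (cvec (normal u (next c u)))) y <= (det u (next c u))%:~R.
Proof. by move=> cc uc /(polygonP _ cc); apply. Qed.

Lemma edge_value u v y : pairing (toQ (cvec (normal u v))) (emb y) = (det u v)%:~R <->
  turn u v y = 0.
Proof.
rewrite pairing_emb dot_normal; split=> [/intr_inj|->]; first by lia.
by rewrite subr0.
Qed.

Lemma turn_eq0 c u y : cvx c -> u \in c -> y \in c -> turn u (next c u) y = 0 ->
  y = u \/ y = next c u.
Proof.
move=> cc uc yc t0; case: (eqVneq y u) => [|n1]; first by left.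
case: (eqVneq y (next c u)) => [|n2]; first by right.
by have := cvx_turn cc uc yc n1 n2; rewrite t0.
Qed.

(* The sum of the outer normals of the two edges at [x] exposes [x]. *)
Lemma exposed c x : cvx c -> x \in c -> exists (g : 'cV[rat]_2) (m : rat),
  [/\ 0 < m, pairing g (emb x) = m, forall y, polygon c y -> pairing g y <= m &
      forall y, polygon c y -> pairing g y = m -> y = emb x].
Proof.
move=> cc xc; have pc : prev c x \in c by rewrite mem_prev.
have np : next c (prev c x) = x by apply: next_prev; apply: cvx_uniq.
pose g := toQ (cvec (normal (prev c x) x)) + toQ (cvec (normal x (next c x))).
pose m : rat := (det (prev c x) x)%:~R + (det x (next c x))%:~R.
have gE y : pairing g y = pairing (toQ (cvec (normal (prev c x) x))) y +
    pairing (toQ (cvec (normal x (next c x)))) y.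
  by rewrite /g !pairingE !mxE; ring.
have d1 := cvx_det cc pc; rewrite np in d1; have d2 := cvx_det cc xc.
have m0 : 0 < m by rewrite /m addr_gt0 // ltr0z.
have b1 y : polygon c y -> pairing (toQ (cvec (normal (prev c x) x))) y <= (det (prev c x) x)%:~R.
  by move=> py; have := edge_bound cc pc py; rewrite np.
have b2 y := @edge_bound c x y cc xc.
have gm y : polygon c y -> pairing g y <= m.
  by move=> py; rewrite gE lerD ?b1 ?b2.
have gx : pairing g (emb x) = m.
  by rewrite gE /m; congr (_ + _); apply/edge_value; rewrite turn_id.
have only y : y \in c -> pairing g (emb y) = m -> y = x.
  move=> yc; have py := polygon_mem yc; rewrite gE /m => e.
  have e1 : turn (prev c x) x y = 0.
    by apply/edge_value; have := b1 _ py; have := b2 _ py; lra.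
  have e2 : turn x (next c x) y = 0.
    by apply/edge_value; have := b1 _ py; have := b2 _ py; lra.
  have := turn_eq0 cc pc yc; rewrite np => /(_ e1) [yp|//].
  have [//|yn] := turn_eq0 cc xc yc e2.
  by move: d1 d2; rewrite -yp -yn /det; lia.
exists g, m; split=> // y py gy.
have [u [a [b [uc a0 b0 ab [e au bv]]]]] := face_decomposition cc m0 gm py gy.
have vc : next c u \in c by rewrite mem_next.
rewrite e; case: (eqVneq a 0) ab au => [->|an] ab au.
  by rewrite add0r in ab; rewrite scale0r add0r ab scale1r (only _ vc) // bv // ab oner_neq0.
have ux := only _ uc (au isT); case: (eqVneq b 0) ab bv => [->|bn] ab bv.
  by rewrite addr0 in ab; rewrite scale0r addr0 ab scale1r ux.
by rewrite (only _ vc (bv isT)) ux -scalerDl ab scale1r.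
Qed.

Lemma vertices_polygon c : cvx c -> vertices (polygon c) = [set emb x | x in [set` c]].
Proof.
move=> cc; apply/seteqP; split=> [x [g gx]|_ [x /= xc <-]].
  have : face (polygon c) g x by rewrite gx.
  case=> px mx; have [_ /mapP[y yc ->] xy] := hull_max g px.
  exists y => //=; suff : face (polygon c) g (emb y) by rewrite gx.
  split; first exact: polygon_mem.
  by move=> z pz; apply: le_trans xy; apply: mx.
have [g [m [m0 gx gm only]]] := exposed cc xc.
exists g; apply/seteqP; split=> [y [py my]|_ ->].
  apply: only => //; apply/eqP; rewrite eq_le gm //= -gx; apply: my.
  exact: polygon_mem.
by split=> [|y /gm]; [exact: polygon_mem | rewrite gx].
Qed.

Lemma face_scale (Q : set 'rV[rat]_2) (g h : 'cV[rat]_2) (k : rat) : 0 < k ->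
  (forall x, pairing g x = k * pairing h x) -> face Q g = face Q h.
Proof.
move=> k0 e; apply/seteqP; split=> x [qx mx]; split=> // y /mx.
  by rewrite !e ler_pM2l.
by rewrite !e ler_pM2l.
Qed.

Definition edge (c : seq (int * int)) (u : int * int) : set 'rV[rat]_2 :=
  face (polygon c) (toQ (cvec (normal u (next c u)))).

Lemma edge_mem c u y : cvx c -> u \in c -> turn u (next c u) y = 0 -> y \in c -> edge c u (emb y).
Proof.
move=> cc uc t0 yc; split; first exact: polygon_mem.
move=> z pz; rewrite (proj2 (edge_value _ _ _) t0).
exact: edge_bound.
Qed.

Lemma edge_ends c u : cvx c -> u \in c -> edge c u (emb u) /\ edge c u (emb (next c u)).
Proof.
move=> cc uc; split; apply: edge_mem => //; rewrite ?turn_id ?mem_next //.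
Qed.

Lemma edge_mem_turn c u y : cvx c -> u \in c -> edge c u (emb y) -> turn u (next c u) y = 0.
Proof.
move=> cc uc [py my]; apply/edge_value/eqP; rewrite eq_le edge_bound //=.
have := my _ (polygon_mem uc); rewrite (proj2 (edge_value u (next c u) u)) //.
by rewrite turn_id.
Qed.

(** Equal edges have the same ends, and swapped ends are excluded because [det u v] and [det v u]
    cannot both be positive. *)
Lemma edge_inj c : cvx c -> {in c &, injective (edge c)}.
Proof.
move=> cc u v uc vc e.
have [e1 e2] := edge_ends cc uc; rewrite e in e1 e2.
have nc : next c u \in c by rewrite mem_next.
have t1 := edge_mem_turn cc vc e1; have t2 := edge_mem_turn cc vc e2.
have du := cvx_det cc uc; have dv := cvx_det cc vc.
have [//|h1] := turn_eq0 cc vc uc t1.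
have [h2|h2] := turn_eq0 cc vc nc t2.
  by move: du dv; rewrite -h1 h2 /det; lia.
by move: du; rewrite h2 -h1 /det; lia.
Qed.

(* The midpoint of two distinct points of a facet is not a vertex, so it lies in the relative
   interior of an edge, at both ends of which the facet functional is maximal. *)
Lemma facets_polygon c : cvx c -> facets (polygon c) = [set edge c u | u in [set` c]].
Proof.
move=> cc; apply/seteqP; split=> [F [[g /eqP g0 eF] [x [y [Fx Fy nxy]]]]|_ [u /= uc <-]];
  last first.
  have [e1 e2] := edge_ends cc uc; have du := cvx_det cc uc.
  split.
    exists (toQ (cvec (normal u (next c u)))) => //; apply/eqP/toQ_cvec_neq0.
    by apply/eqP => -[h1 h2]; move: du h1 h2; rewrite /det; lia.
  exists (emb u), (emb (next c u)); split=> // /emb_inj h.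
  by move: du; rewrite -h /det; lia.
rewrite eF in Fx Fy *; case: (Fx) => px mx; case: (Fy) => py my.
pose m := pairing g x.
have gxy : pairing g y = m by apply/eqP; rewrite eq_le mx //= my.
have m0 : 0 < m.
  have [z pz z0] := interior_pairing_gt0 (polygon_interior0 cc) g0.
  exact: lt_le_trans z0 (mx _ pz).
pose z := 2^-1 *: x + 2^-1 *: y + 0 *: y.
have pz : polygon c z by apply: hull_comb => //; lra.
have gz : pairing g z = m by rewrite /z !pairingD !pairingZ gxy -/m; lra.
suff [u uc [gu gv]] : exists2 u, u \in c & pairing g (emb u) = m /\ pairing g (emb (next c u)) = m.
  exists u => //; rewrite /edge.
  have du : 0 < (det u (next c u))%:~R :> rat by rewrite ltr0z cvx_det.
  (* Each of the two functionals takes a single value on the basis [u], [next c u], so they are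
     proportional. *)
  apply/esym; apply: (@face_scale _ _ _ (m / (det u (next c u))%:~R)); first by rewrite divr_gt0.
  move=> w; have [a [b ->]] : exists a b : rat, w = a *: emb u + b *: emb (next c u).
    exists (- pdet (next c u) (w 0 0, w 0 1) / (det u (next c u))%:~R),
      (pdet u (w 0 0, w 0 1) / (det u (next c u))%:~R).
    have dE : (det u (next c u))%:~R = u.1%:~R * (next c u).2%:~R - u.2%:~R * (next c u).1%:~R :>
      rat.
      by rewrite /det rmorphB !rmorphM.
    have dn : (det u (next c u))%:~R != 0 :> rat by rewrite gt_eqF.
    by apply: row2P; rewrite !mxE ?emb0 ?emb1 /pdet /=; move: dn; rewrite dE => dn; field.
  rewrite !pairingD !pairingZ gu gv !(proj2 (edge_value _ _ _)) ?turn_id //.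
  by field; rewrite gt_eqF.
have [u [a [b [uc a0 b0 ab [e au bv]]]]] := face_decomposition cc m0 mx pz gz.
have vc : next c u \in c by rewrite mem_next.
have novertex w : w \in c -> z = emb w -> False.
  move=> wc ew; have [h [k [k0 hw hk only]]] := exposed cc wc.
  have hz : pairing h z = k by rewrite ew.
  have hx := hk _ px; have hy := hk _ py.
  have hx' : pairing h x = k by move: hz; rewrite /z !pairingD !pairingZ; lra.
  have hy' : pairing h y = k by move: hz; rewrite /z !pairingD !pairingZ; lra.
  by apply: nxy; rewrite (only x) // (only y).
exists u => //; split; [apply: au|apply: bv]; apply/eqP => h0.
  apply: (novertex _ vc); rewrite e h0 scale0r add0r.
  by move: ab; rewrite h0 add0r => ->; rewrite scale1r.
apply: (novertex _ uc); rewrite e h0 scale0r addr0.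
by move: ab; rewrite h0 addr0 => ->; rewrite scale1r.
Qed.

(** * Local indices *)

Lemma prim_scaleP (p : int * int) : prim p <-> p <> 0 /\
  forall (t : rat) (w : int * int), 0 < t -> t < 1 ->
    ~ (w.1%:~R = t * p.1%:~R /\ w.2%:~R = t * p.2%:~R).
Proof.
split=> [/primP[y py]|[p0 h]].
  split=> [p0|t w t0 t1 [e1 e2]]; first by move: py; rewrite p0 /det /=; lia.
  have : (det w y)%:~R = t.
    have -> : (det w y)%:~R = t * (det p y)%:~R.
      by rewrite /det !rmorphB !rmorphM /= e1 e2; ring.
    by rewrite py mulr1.
  by move=> e; move: t0 t1; rewrite -e ltr0z -(ltr_int rat) ltr_int -[1]/(1%:~R) ltr_int; lia.
have g0 : gcdz p.1 p.2 != 0.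
  apply/eqP => e; apply: p0; move/eqP: e; rewrite gcdz_eq0 => /andP[/eqP e1 /eqP e2].
  by rewrite [p]surjective_pairing e1 e2.
have gp : 0 < gcdz p.1 p.2 by rewrite lt_neqAle eq_sym g0.
have /dvdzP[a ea] := dvdz_gcdl p.1 p.2; have /dvdzP[b eb] := dvdz_gcdr p.1 p.2.
apply/eqP/eqP; apply: contrapT => /eqP g1.
have g2 : 1 < gcdz p.1 p.2 by move: gp g1; rewrite /coprimez; lia.
have gn : (gcdz p.1 p.2)%:~R != 0 :> rat by rewrite intr_eq0.
apply: (h (gcdz p.1 p.2)%:~R^-1 (a, b)).
- by rewrite invr_gt0 ltr0z.
- by rewrite invf_lt1 ?ltr0z // ltr1z.
have e1 : p.1%:~R = a%:~R * (gcdz p.1 p.2)%:~R :> rat by rewrite -rmorphM -ea.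
have e2 : p.2%:~R = b%:~R * (gcdz p.1 p.2)%:~R :> rat by rewrite -rmorphM -eb.
by rewrite e1 e2 /=; split; field.
Qed.

Lemma primitive_pt p : primitive (pt p) <-> prim p.
Proof.
split=> [[p0 h]|/prim_scaleP[p0 h]].
  apply/prim_scaleP; split=> [e|t w t0 t1 [e1 e2]].
    by apply: p0; rewrite e; apply: row2P; rewrite !mxE.
  by apply: (h t (pt w) t0 t1); apply: row2P; rewrite !mxE.
split=> [e|t w t0 t1 e].
  by apply: p0; rewrite -(ptK p) e /unpt !mxE.
apply: (h t (unpt w) t0 t1); split.
  by have := congr1 (fun v : 'rV[rat]_2 => v 0 0) e; rewrite !mxE.
by have := congr1 (fun v : 'rV[rat]_2 => v 0 1) e; rewrite !mxE.
Qed.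

Lemma col2P (R : Type) (x y : 'cV[R]_2) : x 0 0 = y 0 0 -> x 1 0 = y 1 0 -> x = y.
Proof.
move=> e0 e1; apply/colP => j.
by case: (eqVneq j 0) => [->//|j0]; have -> : j = 1 by apply/val_inj; case: j j0 => [[|[|]]].
Qed.

Lemma primitive_cvec p : primitive (cvec p) <-> prim p.
Proof.
split=> [[p0 h]|/prim_scaleP[p0 h]].
  apply/prim_scaleP; split=> [e|t w t0 t1 [e1 e2]].
    by apply: p0; rewrite e; apply: col2P; rewrite !mxE.
  by apply: (h t (cvec w) t0 t1); apply: col2P; rewrite !mxE.
split=> [e|t w t0 t1 e].
  by apply: p0; apply: cvec_inj; rewrite e; apply: col2P; rewrite !mxE.
apply: (h t (w 0 0, w 1 0) t0 t1); split.
  by have := congr1 (fun v : 'cV[rat]_2 => v 0 0) e; rewrite !mxE.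
by have := congr1 (fun v : 'cV[rat]_2 => v 1 0) e; rewrite !mxE.
Qed.

Lemma cvecE (eta : 'cV[int]_2) : eta = cvec (eta 0 0, eta 1 0).
Proof. by apply: col2P; rewrite !mxE. Qed.

Lemma edge_lattice_length (u v : int * int) : 0 < det u v ->
  exists (g : int) (n : int * int),
    [/\ 0 < g, prim n, normal u v = (g * n.1, g * n.2) & det u v = g * dot u n] /\
    (eidx u v)%:Z = dot u n.
Proof.
move=> d0; pose g := gcdz (v.1 - u.1) (v.2 - u.2).
have /dvdzP[a ea] := dvdz_gcdl (v.1 - u.1) (v.2 - u.2).
have /dvdzP[b eb] := dvdz_gcdr (v.1 - u.1) (v.2 - u.2).
rewrite -/g in ea eb.
have dE : det u v = g * dot u (b, - a).
  have -> : det u v = u.1 * (v.2 - u.2) - u.2 * (v.1 - u.1) by rewrite /det; ring.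
  by rewrite ea eb /dot /=; ring.
have gp : 0 < g.
  rewrite lt_neqAle; apply/andP; split => //; apply/eqP => g0.
  by move: d0; rewrite dE -g0 mul0r.
have n0 : 0 < dot u (b, - a) by move: d0; rewrite dE pmulr_rgt0.
exists g, (b, - a); split; last first.
  by rewrite /eidx -/g dE mulKz ?gt_eqF // gez0_abs // ltW.
split=> //.
  rewrite /prim /= coprimezN coprimez_sym /coprimez.
  have : gcdz a b * g = 1 * g.
    by rewrite mul1r -{1}(gtz0_abs gp) mulz_gcdl -ea -eb.
  by move/(mulIf (lt0r_neq0 gp)) => ->.
rewrite /normal /=; congr (_, _); first by rewrite eb mulrC.
by rewrite mulrN mulrC -ea opprB.
Qed.

Lemma facet_normalP c u : cvx c -> u \in c ->
  primitive (facet_normal (polygon c) (edge c u)) /\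
  edge c u = face (polygon c) (toQ (facet_normal (polygon c) (edge c u))).
Proof.
move=> cc uc.
apply: (@xgetPex _ 0 [set eta | primitive eta /\ edge c u = face (polygon c) (toQ eta)]).
have [g [n [[g0 pn en _] _]]] := edge_lattice_length (cvx_det cc uc).
exists (cvec n); split; first exact/primitive_cvec.
apply: (@face_scale _ _ _ g%:~R); first by rewrite ltr0z.
by move=> x; rewrite !pairing_cvec en /= !rmorphM /=; ring.
Qed.

(** The chosen normal is known only by its defining property, so uniqueness is shown on the way: it
    is constant along the edge, hence [k] times the primitive normal [n]; primitivity gives [k = 1]
    or [k = -1], and 0 in the polygon excludes -1. *)
Lemma facet_normal_value c u : cvx c -> u \in c -> forall x, edge c u x ->
  pairing (toQ (facet_normal (polygon c) (edge c u))) x = (eidx u (next c u))%:R.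
Proof.
move=> cc uc; have [pe fe] := facet_normalP cc uc.
move: (facet_normal _ _) pe fe => eta; rewrite (cvecE eta).
move: (eta 0 0, eta 1 0) => p /primitive_cvec pp fe x ex.
have [e1 e2] := edge_ends cc uc.
have [g [n [[g0 pn en dn] id]]] := edge_lattice_length (cvx_det cc uc).
have val y z : edge c u y -> edge c u z -> pairing (toQ (cvec p)) y = pairing (toQ (cvec p)) z.
  by rewrite fe => -[py my] [pz mz]; apply/eqP; rewrite eq_le my // mz.
rewrite (val x _ ex e1) pairing_emb; apply/eqP; rewrite -[_%:R]/((_%:Z)%:~R) eqr_int id.
have uv : dot u p = dot (next c u) p.
  by have := val _ _ e1 e2; rewrite !pairing_emb => /intr_inj.
have np : det n p = 0.
  apply: (mulfI (lt0r_neq0 g0)); rewrite mulr0.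
  have -> : g * det n p = det (g * n.1, g * n.2) p by rewrite /det /=; ring.
  by rewrite -en; move: uv; rewrite /dot /det /normal /=; lia.
have up : 0 <= dot u p.
  move: e1; rewrite fe => -[_ /(_ _ (polygon_0 cc))].
  by rewrite pairing0 pairing_emb ler0z.
have un : 0 < dot u n by move: (cvx_det cc uc); rewrite dn pmulr_rgt0.
have /primP[y ny] := pn; have /primP[z pz] := pp.
have [k E1] : exists k, p = (k * n.1, k * n.2).
  exists (det p y); rewrite [LHS]surjective_pairing; congr (_, _).
    have -> : p.1 = p.1 * det n y - y.1 * det n p by rewrite ny np; ring.
    by rewrite /det; ring.
  have -> : p.2 = p.2 * det n y - y.2 * det n p by rewrite ny np; ring.
  by rewrite /det; ring.
have uk : dot u p = k * dot u n by rewrite E1 /dot /=; ring.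
have k1 : (k %| 1)%Z.
  by apply/dvdzP; exists (det n z); transitivity (det p z); [rewrite pz|rewrite E1 /det /=; ring].
move: up; rewrite uk pmulr_lge0 // => k0.
have -> : k = 1 by move: k1 k0; rewrite dvdz1; clear; lia.
by rewrite mul1r.
Qed.

Lemma local_index_edge c u : cvx c -> u \in c ->
  local_index (polygon c) (edge c u) = eidx u (next c u).
Proof.
move=> cc uc; have val := facet_normal_value cc uc.
have := @xgetPex _ 0%N [set l : nat | forall x, edge c u x ->
  pairing (toQ (facet_normal (polygon c) (edge c u))) x = l%:R] (ex_intro _ _ val).
rewrite -/(local_index _ _); have [e1 _] := edge_ends cc uc.
by move=> /(_ _ e1); rewrite val // => /eqP; rewrite eqr_nat => /eqP.
Qed.

Lemma polygon_index_cidx c : cvx c -> polygon_index (polygon c) = cidx c.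
Proof.
move=> cc; rewrite /polygon_index facets_polygon // cidxE fsbig_image; last first.
  by move=> u v; rewrite !inE /= => uc vc; apply: edge_inj.
rewrite -fsbig_seq ?cvx_uniq // big_seq [RHS]big_seq.
by apply: eq_bigr => u uc; apply: local_index_edge.
Qed.

(** * Unimodular equivalence *)

Definition mx_of (M : (int * int) * (int * int)) : 'M[int]_2 :=
  \matrix_(i, j) (let r := if i == 0 then M.1 else M.2 in if j == 0 then r.1 else r.2).

Definition unmx (A : 'M[int]_2) : (int * int) * (int * int) := ((A 0 0, A 0 1), (A 1 0, A 1 1)).

Lemma unmxK : cancel unmx mx_of.
Proof.
move=> A; apply/matrixP => i j; rewrite mxE /unmx.
have h (k : 'I_2) : k != 0 -> k = 1 by move=> k0; apply/val_inj; case: k k0 => [[|[|]]].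
by case: (eqVneq i 0) => [->|/h ->]; case: (eqVneq j 0) => [->|/h ->].
Qed.

Lemma det_mx_of M : \det (mx_of M) = mdet M.
Proof.
rewrite (expand_det_row _ 0) big_ord_recl big_ord1 /cofactor !det_mx11 !mxE /=.
by rewrite /mdet /det /= expr0 expr1; ring.
Qed.

Lemma unitmx_mdet M : (mx_of M \in unitmx) = (mdet M ^+ 2 == 1).
Proof. by rewrite unitmxE det_mx_of sqrf_eq1. Qed.

Lemma emb_act M x : emb (act M x) = emb x *m toQ (mx_of M).
Proof.
apply: row2P; rewrite !mxE big_ord_recl big_ord1 !mxE /=.
  by rewrite /act /= rmorphD !rmorphM.
by rewrite /act /= rmorphD !rmorphM.
Qed.

Lemma hull_image (A : 'M[rat]_2) (s : seq 'rV[rat]_2) :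
  convex_hull [seq x *m A | x <- s] = [set x *m A | x in convex_hull s].
Proof.
have sz : size [seq x *m A | x <- s] = size s by rewrite size_map.
apply/seteqP; split=> [y|_ [x [w [w0 w1 ->]] <-]].
  case=> w [w0 w1 ->].
  exists (\sum_(i < size s) w (cast_ord (esym sz) i) *: s`_i).
    exists (fun i => w (cast_ord (esym sz) i)); split=> //.
    by rewrite -[RHS]w1 (reindex (cast_ord (esym sz))) //; exists (cast_ord sz) => i _;
      rewrite ?cast_ordK ?cast_ordKV.
  rewrite mulmx_suml (reindex (cast_ord (esym sz))) /=.
    by apply: eq_bigr => i _; rewrite -scalemxAl (nth_map 0).
  by exists (cast_ord sz) => i _; rewrite ?cast_ordK ?cast_ordKV.
exists (fun i => w (cast_ord sz i)); split=> //.
  by rewrite -[RHS]w1 [RHS](reindex (cast_ord sz)) //; exists (cast_ord (esym sz)) => i _;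
    rewrite ?cast_ordK ?cast_ordKV.
rewrite mulmx_suml (reindex (cast_ord sz)) /=.
  by apply: eq_bigr => i _; rewrite -scalemxAl (nth_map 0) // -sz.
by exists (cast_ord (esym sz)) => i _; rewrite ?cast_ordK ?cast_ordKV.
Qed.

Lemma polygon_act M c : polygon [seq act M x | x <- c] = [set x *m toQ (mx_of M) | x in polygon c].
Proof.
rewrite /polygon -hull_image -!map_comp; congr convex_hull.
by apply: eq_map => x /=; rewrite emb_act.
Qed.

Lemma polygon_sub c t : {subset c <= t} -> polygon c `<=` polygon t.
Proof. by move=> ct; apply: hull_sub => _ /mapP[x xc ->]; apply/polygon_mem/ct. Qed.

Lemma polygon_eq c t : c =i t -> polygon c = polygon t.
Proof. by move=> ct; apply/seteqP; split; apply: polygon_sub => x; rewrite ct. Qed.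

Lemma equiv_polygon c t : equiv c t -> unimodular_equiv (polygon c) (polygon t).
Proof.
move=> [M [d1 e]]; exists (mx_of M); first by rewrite unitmx_mdet d1.
by rewrite -polygon_act; apply/esym/polygon_eq.
Qed.

(** The face of the image for [u] is the image of the face of [Q] for [A *m u], so one-point faces
    correspond. *)
Lemma vertices_image (Q : set 'rV[rat]_2) (A : 'M[rat]_2) : A \in unitmx ->
  vertices [set x *m A | x in Q] = [set x *m A | x in vertices Q].
Proof.
move=> uA; have inj := can_inj (mulmxK uA : cancel (fun x : 'rV_2 => x *m A) _).
have pA (u : 'cV[rat]_2) x : pairing u (x *m A) = pairing (A *m u) x by rewrite /pairing mulmxA.
have faceA u : face [set x *m A | x in Q] u = [set x *m A | x in face Q (A *m u)].
  apply/seteqP; split=> [_ [[x Qx <-] mx]|_ [x [Qx mx] <-]].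
    by exists x => //; split=> // y Qy; rewrite -!pA; apply: mx; exists y.
  split; first by exists x.
  by move=> _ [y Qy <-]; rewrite !pA; apply: mx.
apply/seteqP; split=> [y [u hu]|_ [x [u hu] <-]].
  have : face [set x *m A | x in Q] u y by rewrite hu.
  rewrite faceA => -[x fx xy]; exists x => //; exists (A *m u).
  apply/seteqP; split=> [z fz|_ ->//].
  have : face [set x *m A | x in Q] u (z *m A) by rewrite faceA; exists z.
  by rewrite hu => e2; apply: inj; rewrite xy e2.
exists (invmx A *m u); rewrite faceA mulKVmx // hu.
by apply/seteqP; split=> [_ [z -> <-]|_ ->] //; exists x.
Qed.

Lemma polygon_equiv c t : cvx c -> cvx t ->
  unimodular_equiv (polygon c) (polygon t) -> equiv c t.
Proof.
move=> cc ct [A uA e]; exists (unmx A); split.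
  by apply/eqP; rewrite -unitmx_mdet unmxK.
have uQ : toQ A \in unitmx.
  by rewrite unitmxE /toQ det_map_mx unitfE intr_eq0; move: uA; rewrite unitmxE;
    apply: contraTneq => ->.
have := vertices_image (polygon c) uQ; rewrite -e !vertices_polygon // => ev y.
apply/mapP/idP => [[x xc ->]|yt].
  have : [set emb x | x in [set` t]] (emb (act (unmx A) x)).
    by rewrite ev emb_act unmxK; exists (emb x) => //; exists x.
  by case=> z /= zt /emb_inj <-.
have : [set emb x | x in [set` t]] (emb y) by exists y.
rewrite ev => -[_ [x /= xc <-]]; rewrite -{1}(unmxK A) -emb_act => /emb_inj <-.
by exists x.
Qed.

Lemma equiv_sym c t : equiv c t -> equiv t c.
Proof.
move=> [M [d1 e]]; exists (minv M); split.
  have -> : mdet (minv M) = mdet M ^+ 2 * mdet M by rewrite {1}/mdet /minv /det /= /mdet /det; ring.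
  by rewrite d1 mul1r.
move=> y; apply/mapP/idP => [[z]|yc].
  by rewrite -e => /mapP[x xc ->] ->; rewrite act_minv.
by exists (act M y); rewrite ?act_minv // -e map_f.
Qed.

(** * The thirty classes of LDP-polygons *)

Lemma table_equiv_inj i j : (i < 30)%N -> (j < 30)%N ->
  equiv (nth [::] table i) (nth [::] table j) -> i = j.
Proof.
move=> i30 j30 e.
have cv k : (k < 30)%N -> cvx (nth [::] table k).
  by move=> k30; have /(allP table_polygons)/and3P[] : nth [::] table k \in table
    by rewrite mem_nth ?size_table.
have ne k l : (k < l)%N -> (l < 30)%N -> ~ equiv (nth [::] table k) (nth [::] table l).
  move=> kl l30 /(equivP _ (cv _ (ltn_trans kl l30))); apply/negP.
  by apply: (pairwiseP [::] table_inequiv); rewrite ?inE /= ?size_table // (ltn_trans kl).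
case: (ltngtP i j) => // ij; first by case: (ne _ _ ij j30).
by case: (ne _ _ ij i30); apply: equiv_sym.
Qed.

Lemma LDP_polygonP c : cvx c -> all prim c -> LDP_polygon (polygon c).
Proof.
move=> cc pc; have p0 := polygon_interior0 cc; split=> //.
  split; last by exists 0.
  by exists [seq pt x | x <- c]; rewrite -map_comp.
move=> x; rewrite vertices_polygon // => -[y /= yc <-]; exists (pt y) => //.
by apply/primitive_pt; apply: (allP pc).
Qed.

(** The cycle comes from gift wrapping the generating points; its edges support all of them, so by
    [polygonP] its hull is still all of [Q]. *)
Lemma LDP_exists Q : LDP_polygon Q -> exists c, [/\ cvx c, all prim c & Q = polygon c].
Proof.
move=> [[[s eQ] _] Q0 prV].
have eS : Q = polygon [seq unpt v | v <- s].
  by rewrite eQ /polygon -map_comp; congr convex_hull; apply: eq_map => v /=; rewrite /emb unptK.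
rewrite eS in Q0 prV *; move: [seq unpt v | v <- s] Q0 prV => S Q0 prV.
have [c [cc cS cyc]] := cvx_exists (interior_surrounds Q0).
have ec : polygon S = polygon c.
  apply/seteqP; split; last exact: polygon_sub.
  move=> x Sx; apply/polygonP => // u uc.
  apply: hull_le Sx => _ /mapP[y yS ->].
  rewrite pairing_emb ler_int dot_normal lerBlDr lerDl.
  have /and4P[_ _ _ /allP h] := next_cycle cyc uc.
  by case/orP: (h y yS) => [/ltW//|/andP[/eqP ->]].
exists c; split=> //; apply/allP => x xc.
have [|v pv e] := prV (emb x).
  by rewrite ec vertices_polygon //; exists x.
by apply/primitive_pt; rewrite (toQ_inj e).
Qed.

Theorem theorem3p1 :
  exists P : 'I_30 -> set 'rV[rat]_2,
    [/\ forall i, LDP_polygon (P i) /\ polygon_index (P i) = 2%N,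
        forall i j, unimodular_equiv (P i) (P j) -> i = j
      & forall Q : set 'rV[rat]_2, LDP_polygon Q -> polygon_index Q = 2%N ->
          exists i, unimodular_equiv Q (P i)].
Proof.
have tabP (i : 'I_30) : nth [::] table i \in table by rewrite mem_nth // size_table.
have tabc t : t \in table -> [/\ cvx t, all prim t & cidx t = 2%N].
  by move=> /(allP table_polygons)/and3P[? ? /eqP ?].
exists (fun i => polygon (nth [::] table i)); split.
- move=> i; have [ct pt it] := tabc _ (tabP i); split; first exact: LDP_polygonP.
  by rewrite polygon_index_cidx.
- move=> i j; have [ci _ _] := tabc _ (tabP i); have [cj _ _] := tabc _ (tabP j).
  by move=> /(polygon_equiv ci cj)/table_equiv_inj e; apply/val_inj/e.
move=> Q LQ; have [c [cc pc ->]] := LDP_exists LQ.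
rewrite polygon_index_cidx // => ic; have [t tt et] := classification cc pc ic.
have it : (index t table < 30)%N by rewrite -size_table index_mem.
by exists (Ordinal it); rewrite /= nth_index //; apply: equiv_polygon.
Qed.
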